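(* Let $(M_1^{(m)},M_2^{(m)})$, $m=1,\dots,n$, be independent copies of the pair of chains with parameters $(\bm{\alpha},\bm{P},\bm{U},\bm{Q}_1,\bm{Q}_2)$, let $(N_1^{(m)},N_2^{(m)})$ be the corresponding pairs of termination times, and let $\xi:=\{(N_1^{(m)},N_2^{(m)})=(n_1^{(m)},n_2^{(m)})\}_{m=1}^n$ be the observed data (with $f_{\tau_1,\tau_2}(n_1^{(m)},n_2^{(m)})>0$ for all $m$). Then, with the convention that any term containing a negative power of a matrix is zero and that $f_{\tau_1,\tau_2|M_1,M_2}(a,b|j)=0$ unless $a,b\ge2$, the conditional expectations required in the E-step of the EM algorithm are: $$\mathbb{E}[A_i\mid\xi]=\sum_{m=1}^n\frac{\alpha_i f_{\tau_1,\tau_2|M_1,M_2}(n_1^{(m)},n_2^{(m)}|i)}{f_{\tau_1,\tau_2}(n_1^{(m)},n_2^{(m)})}\quad(i\in\mathcal{E}),$$ $$\mathbb{E}[N_{ij}^A\mid\xi]=\sum_{m=1}^n\sum_{t\ge1}\frac{(\bm{\alpha}\bm{P}^{t-1})_i\,p_{ij}\,f_{\tau_1,\tau_2|M_1,M_2}(n_1^{(m)}-t,n_2^{(m)}-t|j)}{f_{\tau_1,\tau_2}(n_1^{(m)},n_2^{(m)})}\quad(i,j\in\mathcal{E}),$$ $$\mathbb{E}[N_{ij}^T\mid\xi]=\sum_{m=1}^n\sum_{t\ge1}\frac{(\bm{\alpha}\bm{P}^{t-1})_i\,u_{ij}\,(\bm{Q}_1^{n_1^{(m)}-t-1}\bm{q}_1)_j(\bm{Q}_2^{n_2^{(m)}-t-1}\bm{q}_2)_j}{f_{\tau_1,\tau_2}(n_1^{(m)},n_2^{(m)})}\quad(i\in\mathcal{E},j\in\mathcal{S}),$$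 and for $i,j\in\mathcal{S}$, $$\mathbb{E}[N_{ij}^{B,1}\mid\xi]=\sum_{m=1}^n\sum_{t\ge2}\sum_{\ell=1}^{t-1}\sum_{r\in\mathcal{S}}\frac{(\bm{\alpha}\bm{P}^{\ell-1}\bm{U})_r(\bm{Q}_1^{t-\ell-1})_{ri}\,q_{1,ij}\,(\bm{Q}_1^{n_1^{(m)}-t-1}\bm{q}_1)_j(\bm{Q}_2^{n_2^{(m)}-\ell-1}\bm{q}_2)_r}{f_{\tau_1,\tau_2}(n_1^{(m)},n_2^{(m)})},$$ $$\mathbb{E}[N_{ij}^{B,2}\mid\xi]=\sum_{m=1}^n\sum_{t\ge2}\sum_{\ell=1}^{t-1}\sum_{r\in\mathcal{S}}\frac{(\bm{\alpha}\bm{P}^{\ell-1}\bm{U})_r(\bm{Q}_2^{t-\ell-1})_{ri}\,q_{2,ij}\,(\bm{Q}_2^{n_2^{(m)}-t-1}\bm{q}_2)_j(\bm{Q}_1^{n_1^{(m)}-\ell-1}\bm{q}_1)_r}{f_{\tau_1,\tau_2}(n_1^{(m)},n_2^{(m)})},$$ $$\mathbb{E}[N_i^{B,1}\mid\xi]=\sum_{m=1}^n\sum_{t\ge2}\sum_{\ell=1}^{t-1}\sum_{r\in\mathcal{S}}\frac{(\bm{\alpha}\bm{P}^{\ell-1}\bm{U})_r(\bm{Q}_1^{t-\ell-1})_{ri}\,q_{1,i}\,(\bm{Q}_2^{n_2^{(m)}-\ell-1}\bm{q}_2)_r}{f_{\tau_1,\tau_2}(n_1^{(m)},n_2^{(m)})},$$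 $$\mathbb{E}[N_i^{B,2}\mid\xi]=\sum_{m=1}^n\sum_{t\ge2}\sum_{\ell=1}^{t-1}\sum_{r\in\mathcal{S}}\frac{(\bm{\alpha}\bm{P}^{\ell-1}\bm{U})_r(\bm{Q}_2^{t-\ell-1})_{ri}\,q_{2,i}\,(\bm{Q}_1^{n_1^{(m)}-\ell-1}\bm{q}_1)_r}{f_{\tau_1,\tau_2}(n_1^{(m)},n_2^{(m)})}.$$ Here, for $n_1,n_2\ge2$, $$f_{\tau_1,\tau_2}(n_1,n_2)=\sum_{s=1}^{\min\{n_1,n_2\}-1}\bm{\alpha}\bm{P}^{s-1}\bm{U}\left((\bm{Q}_1^{n_1-s-1}\bm{q}_1)\odot(\bm{Q}_2^{n_2-s-1}\bm{q}_2)\right),$$ and $f_{\tau_1,\tau_2|M_1,M_2}(n_1,n_2|i)$ is the same expression with $\bm{\alpha}$ replaced by $\bm{e}_i^\intercal$.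
   Context: Construction. $\mathcal{E}$ and $\mathcal{S}$ are disjoint nonempty finite sets. $\bm{\alpha}=(\alpha_i)$ is a probability row vector indexed by $\mathcal{E}$; $\bm{P}=\{p_{ij}\}$ is a subprobability matrix (nonnegative entries, row sums at most $1$) on $\mathcal{E}$; $\bm{U}=\{u_{ij}\}$ is a nonnegative $\mathcal{E}\times\mathcal{S}$ matrix such that each row of $(\bm{P}\ \bm{U})$ sums to one; $\bm{Q}_k=\{q_{k,ij}\}$, $k\in\{1,2\}$, are subprobability matrices on $\mathcal{S}$; $\bm{q}_k=\bm{1}-\bm{Q}_k\bm{1}$ with entries $q_{k,i}$, where $\bm{1}$ is a column vector of ones. All chains are assumed to terminate almost surely. $M_1$ is a terminating Markov chain (time $0,1,2,\dots$) on $\mathcal{E}\cup\mathcal{S}$ with initial vector $(\bm{\alpha},\bm{0})$ and subprobability transition matrix $\begin{pmatrix}\bm{P}&\bm{U}\\ \bm{0}&\bm{Q}_1\end{pmatrix}$ (the missing mass in a row is the probability of terminating, i.e. jumping to an absorbing state, at the next step). Let $\tau_{1,2}:=\inf\{t\ge 1: M_1(t)\notin\mathcal{E}\}$. Set $M_2(t)=M_1(t)$ for $t\le\tau_{1,2}$; after time $\tau_{1,2}$, given the past up to $\tau_{1,2}$, $M_2$ evolves independently of $M_1$ as a terminating Markov chain in $\mathcal{S}$ with subprobability matrix $\bm{Q}_2$. For $k\in\{1,2\}$, $\tau_k:=\inf\{t\ge 1: M_k(t)\notin\mathcal{E}\cup\mathcal{S}\}$ is the termination time. The function $f_{\tau_1,\tau_2}$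 is the joint probability mass function of $(\tau_1,\tau_2)$, and $f_{\tau_1,\tau_2|M_1,M_2}(\cdot,\cdot|i)$ is its conditional version given $M_1(0)=M_2(0)=i\in\mathcal{E}$. Statistics of the $n$ copies: $A_i$ is the number of the processes $M_1^{(1)},\dots,M_1^{(n)}$ that start in state $i\in\mathcal{E}$; $N^A_{ij}$ is the total number of jumps (one-step transitions, including $i=j$) of these processes from $i\in\mathcal{E}$ to $j\in\mathcal{E}$; $N^T_{ij}$ is the total number of their jumps from $i\in\mathcal{E}$ to $j\in\mathcal{S}$; for $k\in\{1,2\}$, $N^{B,k}_{ij}$ is the total number of jumps of $M_k^{(1)},\dots,M_k^{(n)}$ from $i\in\mathcal{S}$ to $j\in\mathcal{S}$, and $N^{B,k}_i$ is the total number of their jumps from $i\in\mathcal{S}$ to the absorbing state (termination). $\odot$ is the entrywise product of vectors, $\bm{e}_i$ is the $i$-th canonical column vector, zeroth powers of matrices are the identity.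
   Formalization: The two formulas for E[N_i^{B,1}|ξ] and E[N_i^{B,2}|ξ] are false as printed (the sum over t ignores the termination time); the formal version inserts the factor 1{t = n_k^{(m)}} into their summands, k = 1, 2. *)

(* Defs.v *)
From HB Require Import structures.
From mathcomp Require Import all_boot all_order all_algebra.
From mathcomp Require Import all_classical all_reals all_analysis.
Set Implicit Arguments.
Unset Strict Implicit.
Unset Printing Implicit Defensive.
Import Order.TTheory GRing.Theory Num.Theory.
Local Open Scope classical_set_scope.
Local Open Scope ring_scope.

(* A terminating chain on d states is a process in option 'I_d; None is the
   absorbing state.  The sets E and S are 'I_nE and 'I_nS, and their disjoint
   union is 'I_(nE + nS). *)
Section States.
Variables nE nS : nat.
Definition stE (i : 'I_nE) : option 'I_(nE + nS) := Some (lshift nS i).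
Definition stS (j : 'I_nS) : option 'I_(nE + nS) := Some (rshift nE j).
Definition stS_opt (y : option 'I_nS) : option 'I_(nE + nS) :=
  omap (@rshift nE nS) y.
Definition inE_set (x : option 'I_(nE + nS)) : bool := [exists i, x == stE i].
End States.

Section Model.
Variable R : realType.

Definition prob_vec n (a : 'rV[R]_n) : Prop :=
  (forall i, 0 <= a 0 i) /\ \sum_i a 0 i = 1.
Definition subprob n (A : 'M[R]_n) : Prop :=
  (forall i j, 0 <= A i j) /\ (forall i, \sum_j A i j <= 1).

Record params_ok nE nS (alpha : 'rV[R]_nE) (P : 'M[R]_nE) (U : 'M[R]_(nE, nS))
    (Q1 Q2 : 'M[R]_nS) : Prop := ParamsOk {
  po_nE : (0 < nE)%N ;
  po_nS : (0 < nS)%N ;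
  po_alpha : prob_vec alpha ;
  po_P : subprob P ;
  po_U : forall i j, 0 <= U i j ;
  po_PU : forall i, \sum_j (row_mx P U) i j = 1 ;
  po_Q1 : subprob Q1 ;
  po_Q2 : subprob Q2 }.

Definition ones n : 'cV[R]_n := const_mx 1.
Definition exitv n (Q : 'M[R]_n) : 'cV[R]_n := ones n - Q *m ones n.

Definition trans n (A : 'M[R]_n) (x y : option 'I_n) : R :=
  match x, y with
  | Some i, Some j => A i j
  | Some i, None => exitv A i 0
  | None, Some _ => 0
  | None, None => 1
  end.

(* Negative powers are set to 0, so that every product containing one is 0. *)
Definition mpow n (A : 'M[R]_n) (k : int) : 'M[R]_n :=
  if k is Posz m then A ^+ m else 0.

Definition odot n (u v : 'cV[R]_n) : 'cV[R]_n := map2_mx *%R u v.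

Definition pmf_expr nE nS (a : 'rV[R]_nE) (P : 'M[R]_nE) (U : 'M[R]_(nE, nS))
    (Q1 Q2 : 'M[R]_nS) (n1 n2 : nat) : R :=
  \sum_(1 <= s < minn n1 n2)
    (a *m mpow P (s%:Z - 1) *m U *m
       odot (mpow Q1 (n1%:Z - s%:Z - 1) *m exitv Q1)
            (mpow Q2 (n2%:Z - s%:Z - 1) *m exitv Q2)) 0 0.

(* The pmf of the two termination times given the common initial state i.  It is
   given by the formula, not as a ratio of probabilities, since it is also used
   for states i with alpha_i = 0.  Because it vanishes unless both arguments
   are at least 2, it may be applied to truncated differences n - t in nat. *)
Definition pmf_from nE nS (P : 'M[R]_nE) (U : 'M[R]_(nE, nS))
    (Q1 Q2 : 'M[R]_nS) (n1 n2 : nat) (i : 'I_nE) : R :=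
  if (2 <= n1)%N && (2 <= n2)%N
  then pmf_expr (delta_mx 0 i) P U Q1 Q2 n1 n2 else 0.
End Model.

(* inf {t >= 1 : A (x t)}, with None for the infimum of the empty set. *)
Definition first_time (X : Type) (A : pred X) (x : nat -> X) : option nat :=
  match pselect (exists t, (1 <= t)%N && A (x t)) with
  | left h => Some (ex_minn h)
  | right _ => None
  end.

Definition time_le (t : nat) (tau : option nat) : bool :=
  if tau is Some s then (t <= s)%N else true.

Section Processes.
Context d (T : measurableType d) (R : realType) (Pr : probability T R).

Definition cprob (A B : set T) : R := fine (Pr (A `&` B)) / fine (Pr B).

Definition cexp (X : T -> \bar R) (B : set T) : \bar R :=
  ((\int[Pr]_(w in B) X w) / Pr B)%E.

Definition measurable_process n (X : nat -> T -> option 'I_n) : Prop :=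
  forall t x, measurable [set w | X t w = x].

Record terminating_chain n (a : 'rV[R]_n) (A : 'M[R]_n)
    (X : nat -> T -> option 'I_n) : Prop := TerminatingChain {
  tc_meas : measurable_process X ;
  tc_init : forall i, Pr [set w | X 0%N w = Some i] = (a 0 i)%:E ;
  tc_step : forall (t : nat) (x : nat -> option 'I_n) (y : option 'I_n),
    let past := [set w | forall u, (u <= t)%N -> X u w = x u] in
    (0 < Pr past)%E -> cprob [set w | X t.+1 w = y] past = trans A (x t) y }.

Definition term_time n (X : nat -> T -> option 'I_n) (w : T) : option nat :=
  first_time (fun x => x == None) (fun t => X t w).

Definition exit_time nE nS (X : nat -> T -> option 'I_(nE + nS)) (w : T) :
    option nat :=
  first_time (fun x => ~~ inE_set x) (fun t => X t w).

(* The conditioning event for the evolution after tau_{1,2}. *)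
Definition past_upto nE nS (M1 : nat -> T -> option 'I_(nE + nS))
    (l : nat) (x : nat -> option 'I_(nE + nS)) : set T :=
  [set w | exit_time M1 w = Some l /\ forall u, (u <= l)%N -> M1 u w = x u].

Record chain_pair nE nS (alpha : 'rV[R]_nE) (P : 'M[R]_nE)
    (U : 'M[R]_(nE, nS)) (Q1 Q2 : 'M[R]_nS)
    (M1 M2 : nat -> T -> option 'I_(nE + nS)) : Prop := ChainPair {
  cp_M1 : terminating_chain (row_mx alpha 0) (block_mx P U 0 Q1) M1 ;
  cp_M2_meas : measurable_process M2 ;
  cp_agree : forall w t, time_le t (exit_time M1 w) -> M2 t w = M1 t w ;
  cp_M2_step : forall (l b : nat) (x : nat -> option 'I_(nE + nS))
      (z : nat -> option 'I_nS) (y : option 'I_nS),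
    let past := past_upto M1 l x `&`
      [set w | forall u, (u <= b)%N -> M2 (l + u)%N w = stS_opt nE (z u)] in
    (0 < Pr past)%E ->
    cprob [set w | M2 (l + b.+1)%N w = stS_opt nE y] past = trans Q2 (z b) y ;
  cp_indep : forall (l a b : nat) (x y z : nat -> option 'I_(nE + nS)),
    let past := past_upto M1 l x in
    let fut1 := [set w | forall u, (1 <= u <= a)%N -> M1 (l + u)%N w = y u] in
    let fut2 := [set w | forall u, (1 <= u <= b)%N -> M2 (l + u)%N w = z u] in
    (0 < Pr past)%E ->
    cprob (fut1 `&` fut2) past = cprob fut1 past * cprob fut2 past ;
  cp_term1 : {ae Pr, forall w, term_time M1 w <> None} ;
  cp_term2 : {ae Pr, forall w, term_time M2 w <> None} }.

Definition pair_sigma k (M1 M2 : nat -> T -> option 'I_k) : set (set T) :=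
  <<s [set A | exists t x,
         A = [set w | M1 t w = x] \/ A = [set w | M2 t w = x]] >>.

Definition indep_sigmas n (F : 'I_n -> set (set T)) : Prop :=
  forall (J : {set 'I_n}) (B : 'I_n -> set T), (forall m, F m (B m)) ->
    fine (Pr (\bigcap_(m in [set` J]) B m)) = \prod_(m in J) fine (Pr (B m)).

Definition joint_pmf k (M1 M2 : nat -> T -> option 'I_k) (a b : nat) : R :=
  fine (Pr [set w | term_time M1 w = Some a /\ term_time M2 w = Some b]).

Definition observed n k (M1 M2 : 'I_n -> nat -> T -> option 'I_k)
    (n1 n2 : 'I_n -> nat) : set T :=
  [set w | forall m, term_time (M1 m) w = Some (n1 m) /\
                     term_time (M2 m) w = Some (n2 m)].

Definition starts n k (X : 'I_n -> nat -> T -> option 'I_k) (x : option 'I_k)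
    (w : T) : \bar R :=
  (\sum_(m < n) (X m 0%N w == x)%:R%:E)%E.

(* Extended-real valued, as a path that never terminates may jump from x to y
   infinitely often. *)
Definition jumps n k (X : 'I_n -> nat -> T -> option 'I_k) (x y : option 'I_k)
    (w : T) : \bar R :=
  (\sum_(m < n) \sum_(0 <= t <oo)
     ((X m t w == x) && (X m t.+1 w == y))%:R%:E)%E.
End Processes.

(* Main.v *)
Require Import Defs.
From HB Require Import structures.
From mathcomp Require Import all_boot all_order all_algebra.
From mathcomp Require Import all_classical all_reals all_analysis.
From mathcomp Require Import measurable_realfun.
From mathcomp Require Import zify ring.
Import Order.TTheory GRing.Theory Num.Theory.
Local Open Scope classical_set_scope.
Local Open Scope ring_scope.
Set Implicit Arguments.
Unset Strict Implicit.
Unset Printing Implicit Defensive.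

(** Fix one pair of chains and write l for the time at which M1 first leaves E,
and r for the state of S that it enters.  Three facts determine everything.

- Up to time l the two chains are one and the same chain, which moves inside E
  with the matrix P and leaves to S with the matrix U; hence leaving at time l
  to r has probability (alpha P^(l-1) U)_r ([mass_leaves]), and prescribing in
  addition the initial state or a jump before l only inserts factors in this
  matrix product ([mass_start], [mass_jumpEE], [mass_jumpES]).
- Given the past up to l the two futures are independent Markov chains, which
  start from r and move inside S with the matrices Q1 and Q2.  An event of the
  past together with one event for each future therefore has as probability a
  product of three factors ([split_exit]).
- A chain on S with matrix Q terminates exactly n steps after it is in r with
  probability (Q^(n-1) q)_r ([life_law]); a jump from i to j, or from i to
  termination, at a prescribed step splits the matrix product at that step
  ([life_jump], [life_end]).

The observed termination times are finite, so almost surely M1 has left E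
strictly before both of them.  Summing over the finitely many possible l and r
([obs_split]) gives the joint mass function ([pr_obs]) and, for each statistic
and each time t, the probability that the counted jump occurs at time t and
that the termination times take the observed values ([pr_start], [pr_jumpEE],
[pr_jumpES], [pr_jumpSS1], [pr_jumpSS2], [pr_jumpS01], [pr_jumpS02]).

A statistic of the n copies is a sum over copies m and times t of indicators of
events of the m-th pair.  By independence the factors of the other copies cancel
when such an event is conditioned on the whole data ([pr_event_xi]), and
monotone convergence exchanges the sum over t with the integral ([cexp_sum]).

The Markov property is given for single trajectories only.  Since the state
space is finite, an event depending on finitely many steps is a finite disjoint
union of trajectories, so all extensions to such events are finite sums
([total_prob], [markov_cyl], [indep_future]). *)

(** * Probabilities of finitely determined events *)

(** F depends only on the first t steps of a trajectory: such sets of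
trajectories stand for the sigma-algebra of the process at time t, with no
measurability condition since the state space is finite. *)
Definition upto (S : Type) (t : nat) (F : set (nat -> S)) : Prop :=
  forall x x', (forall u, (u <= t)%N -> x u = x' u) -> F x -> F x'.

Lemma measurable_fin d (T : measurableType d) (S : finType) (Y : T -> S)
    (F : set S) :
  (forall s, measurable [set w | Y w = s]) -> measurable [set w | F (Y w)].
Proof.
move=> mY.
have -> : [set w | F (Y w)] = \bigcup_(s in F) [set w | Y w = s].
  apply/seteqP; split=> [w FY|w [s Fs /= ->]//]; by exists (Y w).
by apply: fin_bigcup_measurable => //; exact: finite_finset.
Qed.

Lemma measurable_conj d (T : measurableType d) (A B : set T) :
  measurable [set w | A w] -> measurable [set w | B w] ->
  measurable [set w | A w /\ B w].
Proof. exact: measurableI. Qed.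

(** Only the values at u <= t matter; beyond t, [inord] returns a junk index. *)
Definition path_ext (S : Type) t (p : {ffun 'I_t.+1 -> S}) (u : nat) : S :=
  p (inord u).

Lemma path_extE (S : Type) t (x : nat -> S) u : (u <= t)%N ->
  path_ext [ffun v : 'I_t.+1 => x v] u = x u.
Proof. by move=> ut; rewrite /path_ext ffunE inordK. Qed.

Section Prob.
Context d (T : measurableType d) (R : realType) (Pr : probability T R).

Definition prob (A : set T) : R := fine (Pr A).
Local Notation pr := prob.

Lemma prE A : measurable A -> Pr A = (pr A)%:E.
Proof. by move=> mA; rewrite /prob fineK// fin_num_measure. Qed.

Lemma pr_ge0 A : 0 <= pr A.
Proof. exact/fine_ge0/measure_ge0. Qed.

Lemma pr_iff (A B : set T) : (forall w, A w <-> B w) -> pr A = pr B.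
Proof. by move=> AB; congr prob; apply/seteqP; split=> w /AB. Qed.

Lemma pr_empty (A : set T) : (forall w, ~ A w) -> pr A = 0.
Proof.
move=> A0; rewrite (_ : A = set0) ?/prob ?measure0//.
by rewrite -subset0 => w /A0.
Qed.

Lemma pr_null A B : measurable A -> measurable B -> A `<=` B -> pr B = 0 -> pr A = 0.
Proof.
move=> mA mB AB; rewrite /prob => /eqP; rewrite fine_eq0 ?fin_num_measure// => /eqP B0.
by rewrite (@subset_measure0 _ _ _ Pr A B mA mB AB B0).
Qed.

(** The tool behind every passage from trajectories to events: Y will be the
state at one time, or a whole finite trajectory. *)
Lemma total_prob (S : finType) (Y : T -> S) (A : set T) :
  measurable A -> (forall s, measurable [set w | Y w = s]) ->
  pr A = \sum_s pr [set w | A w /\ Y w = s].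
Proof.
move=> mA mY.
have mAs (s : S) : measurable [set w | A w /\ Y w = s] by exact: measurable_conj.
have AE : A = \bigcup_(s in [set: S]) [set w | A w /\ Y w = s].
  apply/seteqP; split=> [w Aw|w [s _ []]//]; by exists (Y w).
rewrite {1}AE {1}/prob measure_fin_bigcup//; last 2 first.
- exact: finite_finset.
- by move=> s s' _ _ [w /= [[_ <-] [_ <-]]].
rewrite (_ : [set: S] = [set` index_enum S]); last first.
  by apply/seteqP; split=> s //= _; rewrite mem_index_enum.
rewrite -fsbig_seq ?index_enum_uniq// -sum_fine// => s _.
exact: fin_num_measure.
Qed.

Lemma total_prob0 (S : finType) (Y : T -> S) (A : set T) :
  measurable A -> (forall s, measurable [set w | Y w = s]) ->
  (forall s, pr [set w | A w /\ Y w = s] = 0) -> pr A = 0.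
Proof. by move=> mA mY A0; rewrite (total_prob mA mY) big1. Qed.

(** * The Markov property on cylinder events *)

Section Process.
Context (S : finType) (X : nat -> T -> S).
Hypothesis mX : forall t x, measurable [set w | X t w = x].

Lemma measurable_traj t (p : {ffun 'I_t.+1 -> S}) :
  measurable [set w | [ffun u : 'I_t.+1 => X u w] = p].
Proof.
rewrite (_ : [set _ | _] = \bigcap_(u in [set: 'I_t.+1]) [set w | X u w = p u]).
  by apply: fin_bigcap_measurable => // u _; exact: mX.
apply/seteqP; split=> [w /= <- u _|w Xp]; first by rewrite /= ffunE.
by apply/ffunP => u; rewrite ffunE; exact: Xp.
Qed.

Lemma trajP t (p : {ffun 'I_t.+1 -> S}) w : [ffun u : 'I_t.+1 => X u w] = p <->
  forall u : nat, (u <= t)%N -> X u w = path_ext p u.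
Proof.
split=> [<- u ut|Xp]; first by rewrite (path_extE (X^~ w)).
by apply/ffunP => u; rewrite ffunE Xp ?leq_ord// /path_ext inord_val.
Qed.

Lemma upto_ext t (F : set (nat -> S)) (x : nat -> S) : upto t F ->
  F (path_ext [ffun u : 'I_t.+1 => x u]) <-> F x.
Proof.
by move=> uF; split; apply: uF => u ut; rewrite path_extE.
Qed.

Lemma measurable_cyl t F : upto t F -> measurable [set w | F (X^~ w)].
Proof.
move=> uF.
have := @measurable_fin _ _ _ (fun w => [ffun u : 'I_t.+1 => X u w])
  (fun p => F (path_ext p)) (@measurable_traj t).
by congr measurable; apply/seteqP; split=> w /=;
  have [] := upto_ext (X^~ w) uF.
Qed.

(** The Markov property under the restriction of the probability to H.  The
product form makes it meaningful for past events of probability zero, and H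
carries the conditioning on the past for the processes after the exit time. *)
Definition markov_on (H : set T) (K : S -> S -> R) : Prop :=
  forall t (x : nat -> S) y,
    pr [set w | (H w /\ forall u, (u <= t)%N -> X u w = x u) /\ X t.+1 w = y] =
    pr [set w | H w /\ forall u, (u <= t)%N -> X u w = x u] * K (x t) y.

Variables (H : set T) (K : S -> S -> R).
Hypotheses (mH : measurable H) (XK : markov_on H K).

Lemma measurable_Hcyl t F : upto t F -> measurable [set w | H w /\ F (X^~ w)].
Proof. by move=> uF; apply: measurable_conj => //; exact: measurable_cyl uF. Qed.

(** Sum the trajectory form over the trajectories in F that end in x: they all
have the same factor K x y. *)
Lemma markov_cyl t F x y : upto t F ->
  pr [set w | (H w /\ F (X^~ w)) /\ X t w = x /\ X t.+1 w = y] =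
  pr [set w | (H w /\ F (X^~ w)) /\ X t w = x] * K x y.
Proof.
move=> uF.
have mF := measurable_Hcyl uF.
pose Y w := [ffun u : 'I_t.+1 => X u w].
have mA : measurable [set w | (H w /\ F (X^~ w)) /\ X t w = x].
  exact: measurable_conj.
have mB : measurable [set w | (H w /\ F (X^~ w)) /\ X t w = x /\ X t.+1 w = y].
  by apply: measurable_conj => //; exact: measurable_conj.
rewrite (total_prob mB (@measurable_traj t)) (total_prob mA (@measurable_traj t)).
rewrite big_distrl /=; apply: eq_bigr => p _.
have pX := @trajP t p.
have [[Fp px]|nFp] := pselect (F (path_ext p) /\ path_ext p t = x).
  have FX w : (forall u, (u <= t)%N -> X u w = path_ext p u) ->
      F (X^~ w) /\ X t w = x.
    by move=> Xp; split; [apply: uF Fp => u ut; rewrite Xp | rewrite Xp].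
  have := XK t (path_ext p) y; rewrite px => XKp.
  transitivity (pr [set w | H w /\ forall u, (u <= t)%N -> X u w = path_ext p u]
      * K x y); last first.
    congr (_ * _); apply: pr_iff => w; split=> [[Hw Xp]|[[[Hw _] _] /pX]//].
    by split; [have [] := FX w Xp | apply/pX].
  rewrite -XKp; apply: pr_iff => w; split=> [[[[Hw Fw] [_ ?]] /pX]//|[[Hw Xp] ?]].
  by split; [have [] := FX w Xp | apply/pX].
rewrite [LHS]pr_empty ?[X in X * _]pr_empty ?mul0r//.
- move=> w [[[_ Fw] Xt] /pX Xp]; apply: nFp; split; last by rewrite -Xp.
  by apply: uF Fw => u ut; rewrite Xp.
- move=> w [[[_ Fw] [Xt _]] /pX Xp]; apply: nFp; split; last by rewrite -Xp.
  by apply: uF Fw => u ut; rewrite Xp.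
Qed.

(** A chain that is in N cannot be outside N later: some step would leave N, and
each such step has probability zero. *)
Lemma closed_null (N : pred S) u v : (forall x y, N x -> ~~ N y -> K x y = 0) ->
  (u <= v)%N -> pr [set w | H w /\ (N (X u w) /\ ~~ N (X v w))] = 0.
Proof.
move=> KN; elim: v => [|v IHv].
  by rewrite leqn0 => /eqP ->; apply: pr_empty => w [_ [->]].
rewrite leq_eqVlt => /orP[/eqP ->|]; first by apply: pr_empty => w [_ [->]].
rewrite ltnS => uv.
have mC v' : (u <= v')%N -> measurable [set w | H w /\ (N (X u w) /\ ~~ N (X v' w))].
  move=> uv'; apply: (@measurable_Hcyl v' (fun x => N (x u) /\ ~~ N (x v'))).
  by move=> x x' xx'; rewrite !xx'.
have uF : upto v (fun x : nat -> S => N (x u)) by move=> x x' xx'; rewrite xx'.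
apply: (total_prob0 (mC _ (leqW uv)) (mX v)) => x.
have mCx : measurable [set w | (H w /\ (N (X u w) /\ ~~ N (X v.+1 w))) /\ X v w = x].
  by apply: measurable_conj => //; exact: mC (leqW uv).
have [Nx|nNx] := boolP (N x); last first.
  apply: pr_null (IHv uv) => //; first exact: mC.
  by move=> w [[Hw [Nu _]] Xv]; rewrite /= Xv.
apply: (total_prob0 mCx (mX v.+1)) => y.
have [Ny|nNy] := boolP (N y).
  by apply: pr_empty => w [[[_ [_ nN]] _] Xy]; move: nN; rewrite Xy Ny.
rewrite (@pr_iff _ [set w | (H w /\ N (X u w)) /\ X v w = x /\ X v.+1 w = y]).
  by rewrite (markov_cyl _ _ uF) KN ?mulr0.
move=> w; split=> [[[[Hw [Nu _]] ?] ?]//|[[Hw Nu] [Xv Xv1]]].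
by rewrite /= Xv1.
Qed.

(** * Passage through a set of states *)

Section Taboo.
Variables (D : pred S) (k : nat) (g : 'I_k -> S) (A : 'M[R]_k).
Hypotheses (gD : forall i, D (g i))
  (KA : forall i x, D x -> K (g i) x = \sum_j A i j * (x == g j)%:R).

Definition stay t s (x : nat -> S) := forall u, (t <= u <= t + s)%N -> D (x u).

Lemma upto_stay t s : upto (t + s) (stay t s).
Proof.
move=> x x' xx' xD u /andP[tu us]; rewrite -xx'//.
by apply: xD; rewrite tu.
Qed.

Lemma upto_taboo t s F i : upto t F ->
  upto (t + s) (fun x => F x /\ x t = g i /\ stay t s x).
Proof.
move=> uF x x' xx' [Fx [xt xD]]; split.
  by apply: uF Fx => u ut; rewrite xx'// (leq_trans ut) ?leq_addr.
by split; [rewrite -xx' ?leq_addr | exact: upto_stay xx' xD].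
Qed.

(** The chain started from g i and confined to D moves in the image of g with
the matrix A, since K gives no mass to the rest of D; so s confined steps have
the weights A^s.  This is used with D = E and P, and with the states other than
the absorbing one and Q. *)
Lemma taboo t s F i x : upto t F -> D x ->
  pr [set w | (H w /\ F (X^~ w) /\ X t w = g i /\ stay t s (X^~ w)) /\ X (t + s)%N w = x]
  = pr [set w | (H w /\ F (X^~ w)) /\ X t w = g i] *
    \sum_j (A ^+ s) i j * (x == g j)%:R.
Proof.
move=> uF; elim: s x => [|s IHs] y Dy.
  rewrite addn0 expr0.
  rewrite (bigD1 i)//= mxE eqxx mul1r big1 ?addr0; last first.
    by move=> j ji; rewrite mxE eq_sym (negbTE ji) mul0r.
  have [->|yg] := eqVneq y (g i); last first.
    by rewrite mulr0 pr_empty// => w [[_ [_ [-> _]]] ygi]; move: yg; rewrite ygi eqxx.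
  rewrite mulr1; apply: pr_iff => w; split=> [[[? [? []]]]//|[[? ?] Xt]].
  split=> //; split=> //; split=> //; split=> // u.
  by rewrite addn0 -eqn_leq => /eqP <-; rewrite Xt.
rewrite addnS.
set B := [set w | _].
have uFs := @upto_taboo t s F i uF.
have mB : measurable B.
  apply: measurable_conj => //.
  exact: measurable_Hcyl (@upto_taboo t s.+1 F i uF).
rewrite (total_prob mB (mX (t + s))).
pose p := pr [set w | (H w /\ F (X^~ w)) /\ X t w = g i].
transitivity (\sum_x (p * \sum_j (A ^+ s) i j * (x == g j)%:R) * K x y * (D x)%:R).
  apply: eq_bigr => x _; have [Dx|nDx] := boolP (D x); last first.
    rewrite mulr0 pr_empty// => w [[[_ [_ [_ sw]]] _] Xx].
    by move: nDx; rewrite -Xx sw// leq_addr/= addnS leqnSn.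
  rewrite mulr1 -IHs// -(markov_cyl _ _ uFs).
  apply: pr_iff => w; split=> [[[[Hw [Fw [Xt sw]]] ?] ?]|[[Hw [Fw [Xt sw]]] [? Xy]]].
    do 2!split=> //; split=> //; split=> // u /andP[tu us].
    by apply: sw; rewrite tu addnS ltnW.
  do 3!split=> //; split=> //; split=> // u /andP[tu].
  rewrite addnS leq_eqVlt => /orP[/eqP ->|us]; first by rewrite Xy.
  by apply: sw; rewrite tu.
rewrite -/p.
under eq_bigr do rewrite -!mulrA.
rewrite -mulr_sumr; congr (_ * _).
under eq_bigr do rewrite mulr_suml.
rewrite exchange_big /=.
under [RHS]eq_bigr do rewrite exprSr mxE mulr_suml.
rewrite [RHS]exchange_big /=; apply: eq_bigr => j _.
rewrite (bigD1 (g j))//= eqxx gD big1 ?addr0; last first.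
  by move=> x xg; rewrite (negbTE xg) mulr0 mul0r.
rewrite !mulr1 KA// mulr_sumr; apply: eq_bigr => l _; by rewrite mulrA.
Qed.

(** Confinement to D followed by one step to z: with z in S this is the exit
from E, with z the absorbing state it is the termination of a chain on S. *)
Lemma first_passage t s F i z : upto t F ->
  pr [set w | (H w /\ F (X^~ w) /\ X t w = g i /\ stay t s (X^~ w)) /\
              X (t + s).+1 w = z]
  = pr [set w | (H w /\ F (X^~ w)) /\ X t w = g i] *
    \sum_j (A ^+ s) i j * K (g j) z.
Proof.
move=> uF; have uFs := @upto_taboo t s F i uF.
set B := [set w | _].
have mB : measurable B by apply: measurable_conj => //; exact: measurable_Hcyl uFs.
rewrite (total_prob mB (mX (t + s))).
transitivity (\sum_x (pr [set w | (H w /\ F (X^~ w)) /\ X t w = g i] *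
    \sum_j (A ^+ s) i j * (x == g j)%:R) * K x z * (D x)%:R).
  apply: eq_bigr => x _; have [Dx|nDx] := boolP (D x); last first.
    rewrite mulr0 pr_empty// => w [[[_ [_ [_ sw]]] _] Xx].
    by move: nDx; rewrite -Xx sw// leq_addr/=.
  rewrite mulr1 -taboo// -(markov_cyl _ _ uFs).
  by apply: pr_iff => w; split=> [[[? ?] ?]//|[? [? ?]]].
under eq_bigr do rewrite -!mulrA.
rewrite -mulr_sumr; congr (_ * _).
under eq_bigr do rewrite mulr_suml.
rewrite exchange_big /=; apply: eq_bigr => j _.
rewrite (bigD1 (g j))//= eqxx gD big1 ?addr0; last first.
  by move=> x xg; rewrite (negbTE xg) mulr0 mul0r.
by rewrite !mulr1.
Qed.
End Taboo.
End Process.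
End Prob.

(** * The kernel on the two blocks of states *)

Definition hits (S : Type) (z : S) (n : nat) (x : nat -> S) : Prop :=
  (forall u, (u < n)%N -> x u <> z) /\ x n = z.

Definition after (S : Type) (t : nat) (x : nat -> S) : nat -> S :=
  fun u => x (t + u)%N.

Lemma upto_hits (S : Type) (z : S) n : upto n (hits z n).
Proof.
move=> x x' xx' [xz xn]; split; last by rewrite -xx'.
by move=> u un; rewrite -xx'; [exact: xz|exact: ltnW].
Qed.

Section Transitions.
Context (R : realType) (nE nS : nat).
Context (P : 'M[R]_nE) (U : 'M[R]_(nE, nS)) (Q : 'M[R]_nS).
Hypothesis PU1 : forall i, \sum_j (row_mx P U) i j = 1.

Definition kern : option 'I_(nE + nS) -> option 'I_(nE + nS) -> R :=
  trans (block_mx P U 0 Q).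

Lemma kernEE i j : kern (stE nS i) (stE nS j) = P i j.
Proof. exact: block_mxEul. Qed.

Lemma kernES i j : kern (stE nS i) (stS nE j) = U i j.
Proof. exact: block_mxEur. Qed.

Lemma kernSE i j : kern (stS nE i) (stE nS j) = 0.
Proof. by rewrite /kern /= block_mxEdl mxE. Qed.

Lemma kernSS i j : kern (stS nE i) (stS nE j) = Q i j.
Proof. exact: block_mxEdr. Qed.

Lemma exitvE k (A : 'M[R]_k) i : exitv A i 0 = 1 - \sum_j A i j.
Proof.
rewrite !mxE; congr (_ - _); apply: eq_bigr => j _.
by rewrite !mxE mulr1.
Qed.

(** The rows of (P U) sum to one, so that there is no termination from E. *)
Lemma kernE0 i : kern (stE nS i) None = 0.
Proof.
rewrite /kern /= exitvE -(PU1 i); apply/eqP; rewrite subr_eq0; apply/eqP.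
by rewrite !big_split_ord; congr (_ + _); apply: eq_bigr => j _ /=;
  rewrite ?row_mxEl ?row_mxEr ?block_mxEul ?block_mxEur.
Qed.

Lemma kernS0 i : kern (stS nE i) None = exitv Q i 0.
Proof.
rewrite /kern /= !exitvE; congr (_ - _).
rewrite big_split_ord /= big1 ?add0r; last first.
  by move=> j _; rewrite block_mxEdl mxE.
by apply: eq_bigr => j _; rewrite block_mxEdr.
Qed.

Lemma kern0 y : y != None -> kern None y = 0.
Proof. by case: y. Qed.

Lemma stE_inj : injective (@stE nE nS).
Proof. by move=> i j /Some_inj/lshift_inj. Qed.

Lemma stS_inj : injective (@stS nE nS).
Proof. by move=> i j /Some_inj/rshift_inj. Qed.

Lemma inE_setE (i : 'I_nE) : @inE_set nE nS (stE nS i) = true.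
Proof. by apply/existsP; exists i. Qed.

Lemma stE_neq_stS (i : 'I_nE) (r : 'I_nS) : (stE nS i == stS nE r) = false.
Proof. by apply/eqP => /Some_inj/eqP; rewrite eq_lrshift. Qed.

Lemma inE_setS (r : 'I_nS) : @inE_set nE nS (stS nE r) = false.
Proof. by apply/existsP => -[i]; rewrite eq_sym stE_neq_stS. Qed.

Lemma inE_set0 : @inE_set nE nS None = false.
Proof. by apply/existsP => -[]. Qed.

Variant state_spec : option 'I_(nE + nS) -> Prop :=
  | StateE i : state_spec (stE nS i)
  | StateS r : state_spec (stS nE r)
  | State0 : state_spec None.

(** Case analysis on a state, which keeps the two blocks visible. *)
Lemma stateP x : state_spec x.
Proof.
case: x => [k|]; last exact: State0.
by rewrite -(splitK k); case: (fintype.split k) => j; [exact: StateE|exact: StateS].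
Qed.

Lemma kern_inE i x : inE_set x -> kern (stE nS i) x = \sum_j P i j * (x == stE nS j)%:R.
Proof.
case: (stateP x) => [k _|r|]; rewrite ?inE_setS ?inE_set0//.
rewrite kernEE (bigD1 k)//= eqxx mulr1 big1 ?addr0// => j jk.
by rewrite (inj_eq stE_inj) eq_sym (negbTE jk) mulr0.
Qed.

Definition alive (x : option 'I_(nE + nS)) : bool := x != None.

Lemma kern_alive i x : alive x -> kern (stS nE i) x = \sum_j Q i j * (x == stS nE j)%:R.
Proof.
case: (stateP x) => [k _|r _|//].
  by rewrite kernSE big1// => j _; rewrite stE_neq_stS mulr0.
rewrite kernSS (bigD1 r)//= eqxx mulr1 big1 ?addr0// => j jk.
by rewrite (inj_eq stS_inj) eq_sym (negbTE jk) mulr0.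
Qed.

Lemma kern_closedE (x y : option 'I_(nE + nS)) :
  ~~ inE_set x -> ~~ ~~ inE_set y -> kern x y = 0.
Proof.
rewrite negbK; case: (stateP x) => [k|r _|_]; rewrite ?inE_setE//.
  by case: (stateP y) => [k _|k|]; rewrite ?inE_setS ?inE_set0// kernSE.
by case: (stateP y) => [k _|k|]; rewrite ?inE_setS ?inE_set0.
Qed.

Lemma kern_closed0 (x y : option 'I_(nE + nS)) :
  x == None -> ~~ (y == None) -> kern x y = 0.
Proof. by move=> /eqP ->; exact: kern0. Qed.

Context d (T : measurableType d) (Pr : probability T R).
Local Notation pr := (prob Pr).
Variables (X : nat -> T -> option 'I_(nE + nS)) (H : set T).
Hypotheses (mX : measurable_process X) (mH : measurable H)
  (XK : markov_on Pr X H kern).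

Lemma exit_from t s F i r : upto t F ->
  pr [set w | (H w /\ F (X^~ w) /\ X t w = stE nS i /\
      stay (@inE_set nE nS) t s (X^~ w)) /\ X (t + s).+1 w = stS nE r] =
  pr [set w | (H w /\ F (X^~ w)) /\ X t w = stE nS i] * (P ^+ s *m U) i r.
Proof.
move=> uF; rewrite (first_passage mX mH XK inE_setE kern_inE)//.
by rewrite mxE; congr (_ * _); apply: eq_bigr => j _; rewrite kernES.
Qed.

Lemma stay_inE t s F i j : upto t F ->
  pr [set w | (H w /\ F (X^~ w) /\ X t w = stE nS i /\
      stay (@inE_set nE nS) t s (X^~ w)) /\ X (t + s)%N w = stE nS j] =
  pr [set w | (H w /\ F (X^~ w)) /\ X t w = stE nS i] * (P ^+ s) i j.
Proof.
move=> uF; rewrite (taboo mX mH XK inE_setE kern_inE)// ?inE_setE//.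
rewrite (bigD1 j)//= eqxx mulr1 big1 ?addr0// => k kj.
by rewrite (inj_eq stE_inj) eq_sym (negbTE kj) mulr0.
Qed.

Lemma alive_S (r : 'I_nS) : alive (stS nE r). Proof. by []. Qed.

Lemma hits_stay t s x :
  hits None s.+1 (after t x) <-> stay alive t s x
     /\ x (t + s).+1 = None.
Proof.
rewrite /hits /after addnS; split=> -[xu xs]; split=> //.
  move=> u /andP[tu us]; apply/eqP; rewrite -(subnKC tu).
  by apply: xu; rewrite ltnS leq_subLR.
by move=> u; rewrite ltnS => us; apply/eqP/xu; rewrite leq_addr leq_add2l.
Qed.

(** First passage to the absorbing state: n - 1 steps inside S, then the exit
vector.  For n = 0 both sides vanish, as a chain in S is alive. *)
Lemma life_law t n F r : upto t F ->
  pr [set w | ((H w /\ F (X^~ w)) /\ X t w = stS nE r) /\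
              hits None n (after t (X^~ w))] =
  pr [set w | (H w /\ F (X^~ w)) /\ X t w = stS nE r] *
    (mpow Q (n%:Z - 1) *m exitv Q) r 0.
Proof.
move=> uF; case: n => [|s].
  rewrite /= mul0mx mxE mulr0 pr_empty// => w [[_ Xt] [_]].
  by rewrite /after addn0 Xt.
rewrite -addn1 PoszD addrK /= mxE.
under eq_bigr do rewrite -kernS0.
rewrite -(first_passage mX mH XK alive_S kern_alive)//.
apply: pr_iff => w; rewrite addn1; split.
  by move=> [[[? ?] ?] /hits_stay[]].
by move=> [[? [? [? ?]]] ?]; split=> //; apply/hits_stay.
Qed.

Lemma absorbed_null u v : (u <= v)%N ->
  pr [set w | H w /\ (X u w == None /\ ~~ (X v w == None))] = 0.
Proof.
exact: (@closed_null _ _ _ Pr _ _ mX H kern mH XK (fun y => y == None) u v kern_closed0).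
Qed.

Lemma outE_null u v : (u <= v)%N ->
  pr [set w | H w /\ (~~ inE_set (X u w) /\ ~~ ~~ inE_set (X v w))] = 0.
Proof.
exact: (@closed_null _ _ _ Pr _ _ mX H kern mH XK (fun y => ~~ inE_set y) u v kern_closedE).
Qed.

Lemma measurable_absorbed u v :
  measurable [set w | H w /\ (X u w == None /\ ~~ (X v w == None))].
Proof.
apply: (@measurable_Hcyl _ _ _ X mX H mH (maxn u v)
  (fun x => x u == None /\ ~~ (x v == None))).
by move=> x x' xx'; rewrite !xx' ?leq_maxl ?leq_maxr.
Qed.

(** Termination is absorbing, so a cylinder event that sees the chain alive
after it has terminated is null. *)
Lemma revival_null N G u v : upto N G -> (u <= v)%N ->
  (forall x, G x -> x u = None /\ x v <> None) ->
  pr [set w | H w /\ G (X^~ w)] = 0.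
Proof.
move=> uG uv Guv.
apply: pr_null (measurable_Hcyl mX mH uG) (measurable_absorbed u v) _ (absorbed_null uv).
by move=> w [Hw /Guv[/eqP ? /eqP ?]].
Qed.

Lemma upto_life_jump t n s F a b c : upto t F ->
  upto (t + n + s.+1) (fun x : nat -> option 'I_(nE + nS) =>
    (F x /\ x t = a) /\
    (hits None n (after t x) /\ x (t + s)%N = b /\ x (t + s).+1 = c)).
Proof.
move=> uF x x' xx' [[Fx xt] [hx [xs xs1]]]; split; split.
- by apply: uF Fx => u ut; apply: xx'; lia.
- by rewrite -xx'//; lia.
- by apply: upto_hits hx => u un; apply: xx'; lia.
- by rewrite -!xx'//; lia.
Qed.

Lemma alive_at t s F r i : upto t F ->
  pr [set w | (H w /\ F (X^~ w) /\ X t w = stS nE r /\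
      stay alive t s (X^~ w)) /\ X (t + s)%N w = stS nE i] =
  pr [set w | (H w /\ F (X^~ w)) /\ X t w = stS nE r] * (Q ^+ s) r i.
Proof.
move=> uF; rewrite (taboo mX mH XK alive_S kern_alive)//.
rewrite (bigD1 i)//= eqxx mulr1 big1 ?addr0// => k kj.
by rewrite (inj_eq stS_inj) eq_sym (negbTE kj) mulr0.
Qed.

(** Cut at the jump: s steps from r to i, the jump, and by [life_law] a remaining
life of n - s - 1 steps from j.  If the jump comes too late, the right-hand side
vanishes because of the negative power, and the left-hand side because the chain
would leave the absorbing state. *)
Lemma life_jump t n s F r i j : upto t F ->
  pr [set w | ((H w /\ F (X^~ w)) /\ X t w = stS nE r) /\
      (hits None n (after t (X^~ w)) /\
       X (t + s)%N w = stS nE i /\ X (t + s).+1 w = stS nE j)] =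
  pr [set w | (H w /\ F (X^~ w)) /\ X t w = stS nE r] *
    ((Q ^+ s) r i * Q i j * (mpow Q (n%:Z - s%:Z - 2) *m exitv Q) j 0).
Proof.
move=> uF; have uFs := upto_taboo (D := alive) (g := @stS nE nS) (s := s) (i := r) uF.
have [sn|ns] := ltnP s.+1 n; last first.
  have -> : mpow Q (n%:Z - s%:Z - 2) = 0.
    by rewrite (_ : n%:Z - _ - _ = Negz (s.+1 - n)); [|lia].
  rewrite mul0mx mxE !mulr0.
  rewrite -(revival_null (u := t + n) (v := t + s.+1)
    (upto_life_jump (n := n) (s := s) (a := stS nE r) (b := stS nE i)
      (c := stS nE j) uF)); last 2 first.
  - by rewrite leq_add2l.
  - by move=> x [_ [[_ xn] [_ xs]]]; split=> //; rewrite addnS xs.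
  by apply: pr_iff => w; split=> [[[[? ?] ?] ?]|[? [[? ?] ?]]].
pose G x := F x /\ x t = stS nE r /\ stay alive t s x.
have uG : upto (t + s).+1 (fun x => G x /\ x (t + s)%N = stS nE i).
  move=> x x' xx' [Gx xs]; split; last by rewrite -xx'//; exact: leqnSn.
  by apply: uFs Gx => u us; apply: xx'; exact: leqW.
have n1E : (n - s.+1)%N%:Z - 1 = n%:Z - s%:Z - 2 by lia.
rewrite !mulrA -(kernSS i j) -(alive_at s r i uF).
rewrite -(markov_cyl mX mH XK _ _ uFs) -n1E.
transitivity (pr [set w | ((H w /\ (G (X^~ w) /\ X (t + s)%N w = stS nE i)) /\
    X (t + s).+1 w = stS nE j) /\ hits None (n - s.+1) (after (t + s).+1 (X^~ w))]).
  apply: pr_iff => w; split=> [[[[Hw Fw] Xt] [[hu hn] [Xs Xs1]]]|].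
    split; first do 5!split=> //.
      move=> u /andP[tu us]; apply/eqP; rewrite -(subnKC tu); apply: hu; lia.
    split=> [u un|]; last by move: hn; rewrite /after; congr (X _ w = _); lia.
    have := hu (s.+1 + u)%N; rewrite /after.
    by rewrite (_ : (t + (s.+1 + u))%N = ((t + s).+1 + u)%N); [apply|]; lia.
  move=> [[[Hw [[Fw [Xt st]] Xs]] Xs1] [hu hn]]; split=> //; split=> //; split.
    move=> u un; rewrite /after; have [us|us] := leqP u s.
      by apply/eqP/st; rewrite leq_addr leq_add2l.
    have := hu (u - s.+1)%N; rewrite /after.
    by rewrite (_ : ((t + s).+1 + (u - s.+1))%N = (t + u)%N); [apply|]; lia.
  by move: hn; rewrite /after; congr (X _ w = _); lia.
rewrite (life_law _ _ uG); congr (_ * _).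
by apply: pr_iff => w; split=> [[[? [[? [? ?]] ?]] ?]|[[? [? [? ?]]] [? ?]]].
Qed.

(** A jump to the absorbing state is the termination itself, whence s + 1 = n. *)
Lemma life_end t n s F r i : upto t F ->
  pr [set w | ((H w /\ F (X^~ w)) /\ X t w = stS nE r) /\
      (hits None n (after t (X^~ w)) /\
       X (t + s)%N w = stS nE i /\ X (t + s).+1 w = None)] =
  pr [set w | (H w /\ F (X^~ w)) /\ X t w = stS nE r] *
    ((s.+1 == n)%:R * (Q ^+ s) r i * exitv Q i 0).
Proof.
move=> uF; have uFs := upto_taboo (D := alive) (g := @stS nE nS) (s := s) (i := r) uF.
have [<-|sn] := eqVneq s.+1 n.
  rewrite mul1r -kernS0 !mulrA -(alive_at s r i uF) -(markov_cyl mX mH XK _ _ uFs).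
  apply: pr_iff => w; split.
    by move=> [[[Hw Fw] Xt] [/hits_stay[? ?] [? ?]]].
  by move=> [[Hw [Fw [Xt ?]]] [? ?]]; do 2!split=> //; apply/hits_stay.
rewrite !mul0r mulr0; have [ns|ns] := leqP n s; last first.
  apply: pr_empty => w [_ [[hu _] [_ Xs1]]].
  by apply: (hu s.+1); rewrite ?/after ?addnS//; lia.
rewrite -(revival_null (u := t + n) (v := t + s)
  (upto_life_jump (n := n) (s := s) (a := stS nE r) (b := stS nE i)
    (c := None) uF)); last 2 first.
- by rewrite leq_add2l.
- by move=> x [_ [[_ xn] [xs _]]]; split=> //; rewrite xs.
by apply: pr_iff => w; split=> [[[[? ?] ?] ?]|[? [[? ?] ?]]].
Qed.
End Transitions.

(** * Exit and termination times of trajectories *)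

Definition first_at (X : Type) (A : pred X) (n : nat) (x : nat -> X) : Prop :=
  [/\ (0 < n)%N, A (x n) & forall u, (0 < u < n)%N -> ~~ A (x u)].

Lemma first_timeP (X : Type) (A : pred X) (n : nat) (x : nat -> X) :
  first_time A x = Some n <-> first_at A n x.
Proof.
rewrite /first_time; case: pselect => [h|nh].
  case: ex_minnP => m /andP[m0 Am] mmin; split=> [[<-]|[n0 An nA]].
    split=> // u /andP[u0 um]; apply: contraTN um => Au.
    by rewrite -leqNgt mmin// u0.
  congr Some; apply/eqP; rewrite eqn_leq mmin ?n0//=.
  rewrite leqNgt; apply: contraL Am => mn; apply: nA; by rewrite m0.
split=> // -[n0 An _]; exfalso; apply: nh; exists n; by rewrite n0.
Qed.

Lemma upto_first_at (X : Type) (A : pred X) n : upto n (first_at A n).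
Proof.
move=> x x' xx' [n0 An nA]; split=> //; first by rewrite -xx'.
by move=> u /andP[u0 un]; rewrite -xx' ?nA ?u0// ltnW.
Qed.

Section Conditional.
Context d (T : measurableType d) (R : realType) (Pr : probability T R).

(** Turns hypotheses on conditional probabilities, given only for conditioning
events of positive probability, into products that hold without restriction. *)
Lemma prI_cprob (A B : set T) v : measurable A -> measurable B ->
  ((0 < Pr B)%E -> cprob Pr A B = v) -> prob Pr [set w | B w /\ A w] = prob Pr B * v.
Proof.
move=> mA mB ABv.
have -> : prob Pr [set w | B w /\ A w] = prob Pr (A `&` B).
  by apply: pr_iff => w; split=> -[].
have [B0|B0] := eqVneq (prob Pr B) 0.
  rewrite B0 mul0r; apply: (pr_null _ mB _ B0); first exact: measurableI.
  exact: subIsetr.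
have /ABv <- : (0 < Pr B)%E by rewrite prE// lte_fin lt_neqAle eq_sym B0 pr_ge0.
by rewrite /cprob mulrC -/(prob Pr B) divfK.
Qed.
End Conditional.

Lemma sum_option (R : nmodType) (I : finType) (f : option I -> R) :
  \sum_y f y = f None + \sum_i f (Some i).
Proof.
rewrite (bigD1 None)//=; congr (_ + _).
rewrite (reindex_omap Some id)/=; last by case.
by apply: eq_bigl => j; rewrite eqxx.
Qed.

Lemma sum_state (R : nmodType) nE nS (f : option 'I_(nE + nS) -> R) :
  \sum_x f x = f None + (\sum_e f (stE nS e) + \sum_r f (stS nE r)).
Proof. by rewrite sum_option big_split_ord. Qed.

Lemma trans_sum1 (R : realType) k (A : 'M[R]_k) x : \sum_y trans A x y = 1.
Proof.
rewrite sum_option; case: x => [i|]; first by rewrite /= exitvE subrK.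
by rewrite /= big1 ?addr0.
Qed.

Lemma kern_stS_opt (R : realType) nE nS (P : 'M[R]_nE) (U : 'M[R]_(nE, nS)) Q z y :
  kern P U Q (stS_opt nE z) (stS_opt nE y) = trans Q z y.
Proof.
case: z y => [r|] [r'|]//; first exact: kernSS.
exact: kernS0.
Qed.

(** * The two futures after the exit time *)

Section Pair.
Context d (T : measurableType d) (R : realType) (Pr : probability T R).
Context (nE nS : nat) (alpha : 'rV[R]_nE) (P : 'M[R]_nE) (U : 'M[R]_(nE, nS))
  (Q1 Q2 : 'M[R]_nS) (M1 M2 : nat -> T -> option 'I_(nE + nS)).
Hypothesis hp : chain_pair Pr alpha P U Q1 Q2 M1 M2.
Local Notation pr := (prob Pr).

Let mM1 : measurable_process M1 := tc_meas (cp_M1 hp).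
Let mM2 : measurable_process M2 := cp_M2_meas hp.

Lemma measurable_prefix (X : nat -> T -> option 'I_(nE + nS)) l t
    (x : nat -> option 'I_(nE + nS)) : measurable_process X ->
  measurable [set w | forall u, (u <= t)%N -> X (l + u)%N w = x u].
Proof.
move=> mX; pose F x' := forall u, (u <= t)%N -> x' (l + u)%N = x u.
have uF : upto (l + t) F.
  by move=> x' x'' xx' xu u ut; rewrite -xx' ?xu// leq_add2l.
by have := measurable_cyl mX uF.
Qed.

Lemma M1_markov : markov_on Pr M1 setT (kern P U Q1).
Proof.
move=> t x y; pose past := [set w | forall u, (u <= t)%N -> M1 u w = x u].
have mpast : measurable past by exact: (measurable_prefix 0 t x mM1).
have pastE : pr [set w | setT w /\ past w] = pr past by apply: pr_iff => w; split=> // -[].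
rewrite pastE -(prI_cprob _ _ (@tc_step _ _ _ _ _ _ _ _ (cp_M1 hp) t x y))//.
by apply: pr_iff => w; split=> [[[]]|[]].
Qed.

Definition exits (l : nat) : set (nat -> option 'I_(nE + nS)) :=
  first_at (fun x => ~~ inE_set x) l.

Lemma exit_timeP l w : exit_time M1 w = Some l <-> exits l (M1^~ w).
Proof. exact: first_timeP. Qed.

Lemma measurable_exits l : measurable [set w | exits l (M1^~ w)].
Proof. by have := measurable_cyl mM1 (@upto_first_at _ (fun x => ~~ inE_set x) l). Qed.

Lemma past_uptoE l x : past_upto M1 l x =
  [set w | exits l (M1^~ w) /\ forall u, (u <= l)%N -> M1 u w = x u].
Proof. by apply/seteqP; split=> w [/exit_timeP]. Qed.

Lemma measurable_past l x : measurable (past_upto M1 l x).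
Proof.
rewrite past_uptoE; apply: measurable_conj; first exact: measurable_exits.
exact: (measurable_prefix 0 l x mM1).
Qed.

Section Future.
Variables (l : nat) (x : nat -> option 'I_(nE + nS)).
Let past := past_upto M1 l x.
Let mpast : measurable past := measurable_past l x.

Lemma past_l w : past w ->
  [/\ M1 l w = x l, M2 l w = x l & ~~ inE_set (x l)].
Proof.
move=> [el xl]; have /exit_timeP[_ nE_l _] := el.
by rewrite (cp_agree hp) ?el/= -?xl.
Qed.

(** The past up to the exit time is a cylinder event of M1. *)
Lemma M1_future : markov_on Pr (fun u => M1 (l + u)%N) past (kern P U Q1).
Proof.
move=> t z y.
pose F y' := exits l y' /\ (forall u, (u <= l)%N -> y' u = x u) /\
  (forall u, (u <= t)%N -> y' (l + u)%N = z u).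
have uF : upto (l + t) F.
  move=> y' y'' yy' [ey [yx yz]]; split; [|split].
  - by apply: upto_first_at ey => u ul; apply: yy'; rewrite (leq_trans ul) ?leq_addr.
  - by move=> u ul; rewrite -yy' ?yx// (leq_trans ul) ?leq_addr.
  - by move=> u ut; rewrite -yy' ?yz// leq_add2l.
have := markov_cyl mM1 measurableT M1_markov (z t) y uF.
rewrite (_ : pr [set w | _ /\ M1 (l + t)%N w = z t] =
    pr [set w | past w /\ forall u, (u <= t)%N -> M1 (l + u)%N w = z u]).
  move=> <-; apply: pr_iff => w; rewrite /past past_uptoE addnS.
  by split=> [[[[ew wx] wz] wy]|[[_ [ew [wx wz]]] [_ wy]]]; split=> //; split=> //; exact: wz.
apply: pr_iff => w; rewrite /past past_uptoE.
by split=> [[[_ [ew [wx wz]]] _]|[[ew wx] wz]]; split=> //; exact: wz.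
Qed.


Lemma measurable_past2 t z :
  measurable [set w | past w /\ forall u, (u <= t)%N -> M2 (l + u)%N w = z u].
Proof. exact: measurable_conj (mpast) (measurable_prefix l t z mM2). Qed.

Lemma M2_step t z y :
  pr [set w | (past w /\ forall u, (u <= t)%N -> M2 (l + u)%N w = stS_opt nE (z u)) /\
     M2 (l + t.+1)%N w = stS_opt nE y] =
  pr [set w | past w /\ forall u, (u <= t)%N -> M2 (l + u)%N w = stS_opt nE (z u)] *
    trans Q2 (z t) y.
Proof.
apply: prI_cprob; first exact: mM2.
  exact: (measurable_past2 t (fun u => stS_opt nE (z u))).
exact: (cp_M2_step hp).
Qed.

(** The transition probabilities of M2 to S and to the absorbing state add up to
one, which leaves no mass for E. *)
Lemma M2_stepE t z e :
  pr [set w | (past w /\ forall u, (u <= t)%N -> M2 (l + u)%N w = stS_opt nE (z u)) /\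
     M2 (l + t.+1)%N w = stE nS e] = 0.
Proof.
have := measurable_past2 t (fun u => stS_opt nE (z u)).
set Pt := [set w | past w /\ _] => mPt.
have := total_prob Pr mPt (mM2 (l + t.+1)%N).
pose f s := pr [set w | Pt w /\ M2 (l + t.+1)%N w = s].
have fS y : f (stS_opt nE y) = pr Pt * trans Q2 (z t) y by exact: M2_step.
rewrite (sum_state f) addrCA.
have -> : f None + \sum_r f (stS nE r) = pr Pt.
  rewrite -[RHS]mulr1 -(trans_sum1 Q2 (z t)) mulr_sumr sum_option.
  by rewrite -(fS None); congr (_ + _); apply: eq_bigr => r _; rewrite -(fS (Some r)).
move=> /eqP; rewrite -subr_eq subrr eq_sym psumr_eq0; last by move=> *; exact: pr_ge0.
by move=> /allP /(_ e (mem_index_enum _)) /eqP.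
Qed.

Lemma M2_inS t z :
  (exists z', forall u, (u <= t)%N -> z u = stS_opt nE (z' u)) \/
  pr [set w | past w /\ forall u, (u <= t)%N -> M2 (l + u)%N w = z u] = 0.
Proof.
elim: t => [|t [[z' zz']|IH]].
- case E: _ / (stateP (z 0%N)) => [k|r|].
  + right; apply: pr_empty => w [/past_l[_ Ml nEl] Mz].
    by move: nEl; rewrite -Ml -[l]addn0 Mz// E inE_setE.
  + by left; exists (fun=> Some r) => u; rewrite leqn0 => /eqP ->.
  + by left; exists (fun=> None) => u; rewrite leqn0 => /eqP ->.
- have ext y : z t.+1 = stS_opt nE y ->
      exists z', forall u, (u <= t.+1)%N -> z u = stS_opt nE (z' u).
    move=> zy; exists (fun u => if u == t.+1 then y else z' u) => u.
    by rewrite leq_eqVlt; case: eqP => [->//|_ /= ut]; exact: zz'.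
  case E: _ / (stateP (z t.+1)) => [k|r|].
  + right; rewrite -(M2_stepE t z' k); apply: pr_iff => w; split.
      move=> [pw Mz]; split; last by rewrite -E; exact: Mz.
      by split=> // u ut; rewrite -zz'// Mz// leqW.
    move=> [[pw Mz] Mt]; split=> // u; rewrite leq_eqVlt => /orP[/eqP ->|ut]; first by rewrite E.
    by rewrite Mz// zz'.
  + by left; apply: (ext (Some r)).
  + by left; apply: (ext None).
- right; apply: pr_null IH; [exact: measurable_past2 | exact: measurable_past2 |].
  by move=> w [pw Mz]; split=> // u ut; apply: Mz; exact: leqW.
Qed.

(** The steps of M2 are prescribed along trajectories in S and the absorbing
state; all others are null by [M2_inS].  Therefore M2 is a chain with the same
kind of kernel as M1, with Q2 in place of Q1, and every result on a chain with
such a kernel applies to both. *)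
Lemma M2_future : markov_on Pr (fun u => M2 (l + u)%N) past (kern P U Q2).
Proof.
move=> t z y; have mP := measurable_past2 t z.
have [[z' zz']|z0] := M2_inS t z; last first.
  rewrite z0 mul0r; apply: (pr_null _ mP _ z0); last by move=> w [].
  exact: measurable_conj mP (mM2 (l + t.+1)%N y).
have PE w : (past w /\ forall u, (u <= t)%N -> M2 (l + u)%N w = z u) <->
    (past w /\ forall u, (u <= t)%N -> M2 (l + u)%N w = stS_opt nE (z' u)).
  by split=> -[pw Mz]; split=> // u ut; rewrite Mz// zz'.
rewrite (pr_iff _ PE) zz'//.
rewrite (@pr_iff _ _ _ _ _ [set w | (past w /\ forall u, (u <= t)%N ->
    M2 (l + u)%N w = stS_opt nE (z' u)) /\ M2 (l + t.+1)%N w = y]); last first.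
  by move=> w; split=> -[/PE].
case: (stateP y) => [e|r|].
- rewrite M2_stepE; case: (z' t) => [r|]; last by rewrite /kern mulr0.
  by rewrite kernSE mulr0.
- by rewrite (M2_step t z' (Some r)) -(kern_stS_opt P U).
- by rewrite (M2_step t z' None) -(kern_stS_opt P U).
Qed.

(** The model prescribes conditional independence for u >= 1.  At u = 0 both
chains are fixed by the past: if y or z disagrees with it, both sides vanish. *)
Lemma indep_prefix a b (y z : nat -> option 'I_(nE + nS)) :
  let fut1 := [set w | forall u, (u <= a)%N -> M1 (l + u)%N w = y u] in
  let fut2 := [set w | forall u, (u <= b)%N -> M2 (l + u)%N w = z u] in
  pr [set w | past w /\ (fut1 w /\ fut2 w)] * pr past =
  pr [set w | past w /\ fut1 w] * pr [set w | past w /\ fut2 w].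
Proof.
move=> fut1 fut2.
have m1 : measurable fut1 by exact: measurable_prefix.
have m2 : measurable fut2 by exact: measurable_prefix.
have mp1 := measurable_conj mpast m1.
have mp2 := measurable_conj mpast m2.
have mp12 := measurable_conj mpast (measurable_conj m1 m2).
have [p0|p0] := eqVneq (pr past) 0.
  have -> : pr [set w | past w /\ fut1 w] = 0 by apply: (pr_null mp1 _ _ p0) => // w [].
  by rewrite p0 mulr0 mul0r.
have pgt0 : (0 < Pr past)%E by rewrite prE// lte_fin lt_neqAle eq_sym p0 pr_ge0.
have [y0|y0] := eqVneq (y 0%N) (x l); last first.
  have no1 w : past w -> ~ fut1 w.
    move=> /past_l[Ml _ _] /(_ 0%N isT); rewrite addn0 Ml => xy.
    by move: y0; rewrite xy eqxx.
  rewrite (@pr_empty _ _ _ _ [set w | past w /\ (fut1 w /\ fut2 w)]); last first.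
    by move=> w [/no1 pw []].
  rewrite (@pr_empty _ _ _ _ [set w | past w /\ fut1 w]) ?mul0r// => w [/no1].
  by [].
have [z0|z0] := eqVneq (z 0%N) (x l); last first.
  have no2 w : past w -> ~ fut2 w.
    move=> /past_l[_ Ml _] /(_ 0%N isT); rewrite addn0 Ml => xz.
    by move: z0; rewrite xz eqxx.
  rewrite (@pr_empty _ _ _ _ [set w | past w /\ (fut1 w /\ fut2 w)]); last first.
    by move=> w [/no2 pw []].
  rewrite (@pr_empty _ _ _ _ [set w | past w /\ fut2 w]) ?mul0r ?mulr0// => w [/no2].
  by [].
have := @cp_indep _ _ _ _ _ _ _ _ _ _ _ _ _ hp l a b x y z pgt0; rewrite /cprob -/past.
set g1 := [set w | _]; set g2 := [set w | _] => indep.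
have f1 w : past w -> (fut1 w <-> g1 w).
  move=> /past_l[Ml _ _]; split=> [f u /andP[_ ua]|g u ua]; first exact: f.
  by case: u ua => [_|u ua]; [rewrite addn0 Ml y0 | apply: g].
have f2 w : past w -> (fut2 w <-> g2 w).
  move=> /past_l[_ Ml _]; split=> [f u /andP[_ ua]|g u ua]; first exact: f.
  by case: u ua => [_|u ua]; [rewrite addn0 Ml z0 | apply: g].
have e12 : pr [set w | past w /\ (fut1 w /\ fut2 w)] = pr (g1 `&` g2 `&` past).
  apply: pr_iff => w; split=> [[pw [/(f1 _ pw) ? /(f2 _ pw) ?]]//|[[h1 h2] pw]].
  by split=> //; split; [exact/(f1 _ pw) | exact/(f2 _ pw)].
have e1 : pr [set w | past w /\ fut1 w] = pr (g1 `&` past).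
  by apply: pr_iff => w; split=> [[pw /(f1 _ pw) ?]//|[h pw]]; split=> //; exact/(f1 _ pw).
have e2 : pr [set w | past w /\ fut2 w] = pr (g2 `&` past).
  by apply: pr_iff => w; split=> [[pw /(f2 _ pw) ?]//|[h pw]]; split=> //; exact/(f2 _ pw).
have {}indep : pr (g1 `&` g2 `&` past) / pr past =
  (pr (g1 `&` past) / pr past) * (pr (g2 `&` past) / pr past) by [].
rewrite e12 e1 e2.
by rewrite -(divfK p0 (pr (g1 `&` g2 `&` past))) indep; field.
Qed.

(** Both sides are bilinear in the two events, which are sums of trajectories. *)
Lemma indep_future a b (C1 C2 : set (nat -> option 'I_(nE + nS))) :
  upto a C1 -> upto b C2 ->
  pr [set w | past w /\ (C1 (after l (M1^~ w)) /\ C2 (after l (M2^~ w)))] * pr past =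
  pr [set w | past w /\ C1 (after l (M1^~ w))] *
  pr [set w | past w /\ C2 (after l (M2^~ w))].
Proof.
move=> uC1 uC2.
pose X1 u := M1 (l + u)%N; pose X2 u := M2 (l + u)%N.
have mX1 : measurable_process X1 by move=> t s; exact: mM1.
have mX2 : measurable_process X2 by move=> t s; exact: mM2.
have mC1 := measurable_cyl mX1 uC1; have mC2 := measurable_cyl mX2 uC2.
have mp1 := measurable_conj mpast mC1.
have mp2 := measurable_conj mpast mC2.
have mp12 := measurable_conj mpast (measurable_conj mC1 mC2).
have mt1 := @measurable_traj _ _ _ _ mX1 a.
have mt2 := @measurable_traj _ _ _ _ mX2 b.
rewrite [in RHS](total_prob Pr mp1 mt1) [in RHS](total_prob Pr mp2 mt2).
rewrite (total_prob Pr mp12 mt1) big_distrlr/= mulr_suml; apply: eq_bigr => p _.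
rewrite (total_prob Pr (measurable_conj mp12 (mt1 p)) mt2) mulr_suml.
apply: eq_bigr => q _.
have [Cp|nCp] := pselect (C1 (path_ext p)); last first.
  have no w : C1 (X1^~ w) -> [ffun u : 'I_a.+1 => X1 u w] = p -> False.
    by move=> Cw /trajP Xp; apply: nCp; apply: uC1 Cw.
  rewrite [X in X * _ = _]pr_empty; last by move=> w [[[_ [/no h _]] /h]].
  rewrite [X in _ = X * _]pr_empty; last by move=> w [[_ /no h] /h].
  by rewrite !mul0r.
have [Cq|nCq] := pselect (C2 (path_ext q)); last first.
  have no w : C2 (X2^~ w) -> [ffun u : 'I_b.+1 => X2 u w] = q -> False.
    by move=> Cw /trajP Xp; apply: nCq; apply: uC2 Cw.
  rewrite [X in X * _ = _]pr_empty; last by move=> w [[[_ [_ /no h]] _] /h].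
  rewrite [X in _ = _ * X]pr_empty; last by move=> w [[_ /no h] /h].
  by rewrite mul0r mulr0.
have C1p w : (forall u, (u <= a)%N -> X1 u w = path_ext p u) -> C1 (X1^~ w).
  by move=> Xp; apply: uC1 Cp => u ua; rewrite Xp.
have C2q w : (forall u, (u <= b)%N -> X2 u w = path_ext q u) -> C2 (X2^~ w).
  by move=> Xq; apply: uC2 Cq => u ua; rewrite Xq.
have := indep_prefix a b (path_ext p) (path_ext q).
rewrite /=.
rewrite (@pr_iff _ _ _ _ _ [set w | ((past w /\ (C1 (after l (M1^~ w)) /\
   C2 (after l (M2^~ w)))) /\ [ffun u : 'I_a.+1 => X1 u w] = p) /\
   [ffun u : 'I_b.+1 => X2 u w] = q]); last first.
  move=> w; split=> [[pw [h1 h2]]|[[[pw _] /trajP h1] /trajP h2]//].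
  by split; [split; [split=> //; split; [exact: C1p|exact: C2q] | exact/trajP] | exact/trajP].
move=> ->; congr (_ * _); apply: pr_iff => w.
  by split=> [[pw h]|[[pw _] /trajP h]//]; split; [split=> //; exact: C1p|exact/trajP].
by split=> [[pw h]|[[pw _] /trajP h]//]; split; [split=> //; exact: C2q|exact/trajP].
Qed.
End Future.
End Pair.

Section PairFormulas.
Context d (T : measurableType d) (R : realType) (Pr : probability T R).
Context (nE nS : nat) (alpha : 'rV[R]_nE) (P : 'M[R]_nE) (U : 'M[R]_(nE, nS))
  (Q1 Q2 : 'M[R]_nS) (M1 M2 : nat -> T -> option 'I_(nE + nS)).
Hypotheses (hpar : params_ok alpha P U Q1 Q2)
  (hp : chain_pair Pr alpha P U Q1 Q2 M1 M2).
Local Notation pr := (prob Pr).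
Local Notation E := (@inE_set nE nS).

Let PU1 := po_PU hpar.
Let mM1 : measurable_process M1 := tc_meas (cp_M1 hp).
Let mM2 : measurable_process M2 := cp_M2_meas hp.
Let MK1 := M1_markov hp.

(** * Splitting at the exit time *)

(** M1 leaves E at time s + 1, to r.  Unlike the exit time, this also requires
the initial state to be in E, as is almost surely the case; then the confinement
to E is that of [taboo]. *)
Definition leaves s r (x : nat -> option 'I_(nE + nS)) : Prop :=
  stay E 0 s x /\ x s.+1 = stS nE r.

Lemma upto_leaves s r : upto s.+1 (leaves s r).
Proof.
move=> x x' xx' [xs xr]; split; last by rewrite -xx'.
by apply: upto_stay xs => u us; apply: xx'; rewrite add0n in us; exact: leqW.
Qed.

Lemma leaves_exits s r x : leaves s r x -> exits s.+1 x.
Proof.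
move=> [xE xr]; split=> //; first by rewrite xr inE_setS.
by move=> u /andP[_ us]; rewrite negbK xE// add0n -ltnS.
Qed.

Lemma leaves_exit_time s r w : leaves s r (M1^~ w) -> exit_time M1 w = Some s.+1.
Proof. by move=> /leaves_exits/exit_timeP. Qed.

Lemma measurable_leaves s r : measurable [set w | leaves s r (M1^~ w)].
Proof. by have := measurable_cyl mM1 (@upto_leaves s r). Qed.

(** For one past trajectory this is conditional independence, with conditional
probabilities v1 and v2 that depend on the past only through its endpoint r; so
the factors come out of the sum over the past trajectories in F. *)
Lemma split_exit s r F a b C1 C2 v1 v2 :
  upto s.+1 F -> upto a C1 -> upto b C2 ->
  (forall x, x s.+1 = stS nE r ->
    pr [set w | past_upto M1 s.+1 x w /\ C1 (after s.+1 (M1^~ w))] =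
    pr (past_upto M1 s.+1 x) * v1) ->
  (forall x, x s.+1 = stS nE r ->
    pr [set w | past_upto M1 s.+1 x w /\ C2 (after s.+1 (M2^~ w))] =
    pr (past_upto M1 s.+1 x) * v2) ->
  pr [set w | (leaves s r (M1^~ w) /\ F (M1^~ w)) /\
     (C1 (after s.+1 (M1^~ w)) /\ C2 (after s.+1 (M2^~ w)))] =
  pr [set w | leaves s r (M1^~ w) /\ F (M1^~ w)] * (v1 * v2).
Proof.
move=> uF uC1 uC2 Cv1 Cv2.
have mL := measurable_leaves s r.
have mF := measurable_cyl mM1 uF.
have mX1 : measurable_process (fun u => M1 (s.+1 + u)%N) by move=> t x; exact: mM1.
have mX2 : measurable_process (fun u => M2 (s.+1 + u)%N) by move=> t x; exact: mM2.
have mC1 := measurable_cyl mX1 uC1; have mC2 := measurable_cyl mX2 uC2.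
have mt := @measurable_traj _ _ _ _ mM1 s.+1.
have mLF := measurable_conj mL mF.
rewrite (total_prob Pr (measurable_conj mLF (measurable_conj mC1 mC2)) mt).
rewrite (total_prob Pr mLF mt) mulr_suml; apply: eq_bigr => p _.
pose x := path_ext p.
have [[Lx Fx]|nLF] := pselect (leaves s r x /\ F x); last first.
  have no w : leaves s r (M1^~ w) -> F (M1^~ w) ->
      [ffun u : 'I_s.+2 => M1 u w] = p -> False.
    move=> Lw Fw /trajP Mp; apply: nLF; split; first exact: upto_leaves Lw.
    exact: uF Fw.
  rewrite [LHS]pr_empty; last by move=> w [[[/no h /h h'] _] /h'].
  by rewrite [X in X * _]pr_empty ?mul0r// => w [[/no h /h h'] /h'].
have pastE w : past_upto M1 s.+1 x w <->
    (leaves s r (M1^~ w) /\ F (M1^~ w)) /\ [ffun u : 'I_s.+2 => M1 u w] = p.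
  rewrite past_uptoE; split=> [[_ Mx]|[[Lw _] /trajP Mp]]; last first.
    by split; [exact: leaves_exits Lw|].
  split; last exact/trajP.
  by split; [apply: upto_leaves Lx | apply: uF Fx] => u us; rewrite Mx.
have mpast := measurable_past hp s.+1 x.
have := indep_future hp s.+1 x uC1 uC2; rewrite Cv1 ?Cv2; try by case: Lx.
have -> : pr [set w | past_upto M1 s.+1 x w /\
    (C1 (after s.+1 (M1^~ w)) /\ C2 (after s.+1 (M2^~ w)))] =
  pr [set w | ((leaves s r (M1^~ w) /\ F (M1^~ w)) /\
     (C1 (after s.+1 (M1^~ w)) /\ C2 (after s.+1 (M2^~ w)))) /\
     [ffun u : 'I_s.+2 => M1 u w] = p].
  by apply: pr_iff => w; split=> [[/pastE[LF Mp] ?]//|[[LF ?] Mp]]; split=> //; apply/pastE.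
rewrite -(pr_iff _ pastE).
have [p0 _|p0 indep] := eqVneq (pr (past_upto M1 s.+1 x)) 0.
  rewrite p0 mul0r; apply: (pr_null _ mpast _ p0); last first.
    by move=> w [[LF _] Mp]; apply/pastE.
  exact: measurable_conj (measurable_conj mLF (measurable_conj mC1 mC2)) (mt p).
by apply: (mulIf p0); rewrite indep; ring.
Qed.

(** The probability of terminating at time n from r at time l; it is 0 for
n <= l, by the convention on negative powers. *)
Definition surv (Q : 'M[R]_nS) (n l : nat) (r : 'I_nS) : R :=
  (mpow Q (n%:Z - l%:Z - 1) *m exitv Q) r 0.

Lemma past_M1 l x w : past_upto M1 l x w -> M1 l w = x l.
Proof. by case/(past_l hp). Qed.

Lemma past_M2 l x w : past_upto M1 l x w -> M2 l w = x l.
Proof. by case/(past_l hp). Qed.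

Lemma uptoT (S : Type) t : upto t (@setT (nat -> S)). Proof. by []. Qed.

Section Lifetimes.
Variables (X : nat -> T -> option 'I_(nE + nS)) (Q : 'M[R]_nS).
Variables (l : nat) (x : nat -> option 'I_(nE + nS)) (r : 'I_nS).
Local Notation past := (past_upto M1 l x).
Hypotheses (mX : measurable_process X)
  (XK : markov_on Pr (fun u => X (l + u)%N) past (kern P U Q))
  (Xl : forall w, past w -> X l w = x l) (xl : x l = stS nE r).
Let mpast : measurable past := measurable_past hp l x.
Let mXl : measurable_process (fun u => X (l + u)%N).
Proof. by move=> t s; exact: mX. Qed.

(** The past fixes the state at time l, so adding this state to the event, as
the laws of lifetimes require, changes nothing. *)
Lemma past_at_l (C : set T) v :
  pr [set w | ((past w /\ setT (X^~ w)) /\ X (l + 0)%N w = stS nE r) /\ C w] =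
  pr [set w | (past w /\ setT (X^~ w)) /\ X (l + 0)%N w = stS nE r] * v ->
  pr [set w | past w /\ C w] = pr past * v.
Proof.
rewrite addn0 => XC.
have -> : pr past = pr [set w | (past w /\ setT (X^~ w)) /\ X l w = stS nE r].
  apply: pr_iff => w; split=> [pw|[[pw _] _]//].
  by split=> //; rewrite Xl.
rewrite -XC; apply: pr_iff => w; split=> [[pw Cw]|[[[pw _] _] Cw]//].
by do 2!split=> //; rewrite Xl.
Qed.

Lemma past_life n : (l <= n)%N ->
  pr [set w | past w /\ hits None (n - l) (after l (X^~ w))] = pr past * surv Q n l r.
Proof.
move=> ln; apply: past_at_l.
by have := life_law mXl mpast XK (n - l) r (@uptoT _ 0); rewrite -subzn.
Qed.

Lemma past_jump n t i j : (l <= n)%N -> (l <= t)%N ->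
  pr [set w | past w /\ (hits None (n - l) (after l (X^~ w)) /\
    after l (X^~ w) (t - l)%N = stS nE i /\ after l (X^~ w) (t - l).+1 = stS nE j)] =
  pr past * ((Q ^+ (t - l)) r i * Q i j * surv Q n t.+1 j).
Proof.
move=> ln lt; apply: past_at_l.
have := life_jump mXl mpast XK (n - l) (t - l) r i j (@uptoT _ 0).
by rewrite /surv (_ : (n - l)%N%:Z - (t - l)%N%:Z - 2 = n%:Z - t.+1%:Z - 1); last by lia.
Qed.

Lemma past_end n t i : (l <= n)%N -> (l <= t)%N ->
  pr [set w | past w /\ (hits None (n - l) (after l (X^~ w)) /\
    after l (X^~ w) (t - l)%N = stS nE i /\ after l (X^~ w) (t - l).+1 = None)] =
  pr past * ((t.+1 == n)%:R * (Q ^+ (t - l)) r i * exitv Q i 0).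
Proof.
move=> ln lt; apply: past_at_l.
have := life_end mXl mpast XK (n - l) (t - l) r i (@uptoT _ 0).
by rewrite (_ : ((t - l).+1 == (n - l)%N) = (t.+1 == n)); last by lia.
Qed.
End Lifetimes.

(** * Before the exit *)

Lemma init_stE i : pr [set w | M1 0%N w = stE nS i] = alpha 0 i.
Proof. by rewrite /prob (tc_init (cp_M1 hp)) /= row_mxEl. Qed.

Lemma init_stS r : pr [set w | M1 0%N w = stS nE r] = 0.
Proof. by rewrite /prob (tc_init (cp_M1 hp)) /= row_mxEr mxE. Qed.

Lemma init_None : pr [set w | M1 0%N w = None] = 0.
Proof.
have := total_prob Pr measurableT (mM1 0%N).
rewrite {1}/prob probability_setT /=.
have -> : \sum_s pr [set w | setT w /\ M1 0%N w = s] = \sum_s pr [set w | M1 0%N w = s].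
  by apply: eq_bigr => s _; apply: pr_iff => w; split=> // -[].
rewrite sum_state [X in _ + (_ + X)]big1 ?addr0; last by move=> r _; exact: init_stS.
under eq_bigr do rewrite init_stE.
case: (po_alpha hpar) => _ ->.
by rewrite -[X in X = _]add0r => /addIr.
Qed.

Lemma total_init A : measurable A ->
  pr A = \sum_i pr [set w | A w /\ M1 0%N w = stE nS i].
Proof.
move=> mA; rewrite (total_prob Pr mA (mM1 0%N)) sum_state.
rewrite (pr_null _ (mM1 0%N None) _ init_None); last 2 first.
- exact: measurable_conj.
- by move=> w [].
rewrite add0r [X in _ + X]big1 ?addr0// => r _.
apply: (pr_null _ (mM1 0%N _) _ (init_stS r)); last by move=> w [].
exact: measurable_conj.
Qed.

Lemma init_notE : pr [set w | ~~ E (M1 0%N w)] = 0.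
Proof.
rewrite total_init; last by exact: (@measurable_fin _ _ _ (M1 0%N) (fun s => ~~ E s) (mM1 0%N)).
rewrite big1// => i _; apply: pr_empty => w [/= nE0 Mi].
by move: nE0; rewrite Mi inE_setE.
Qed.

Lemma M1_exit_from t s F i r : upto t F ->
  pr [set w | (F (M1^~ w) /\ M1 t w = stE nS i) /\
     (stay E t s (M1^~ w) /\ M1 (t + s).+1 w = stS nE r)] =
  pr [set w | F (M1^~ w) /\ M1 t w = stE nS i] * (P ^+ s *m U) i r.
Proof.
move=> uF.
transitivity (pr [set w | (setT w /\ F (M1^~ w) /\ M1 t w = stE nS i /\
    stay E t s (M1^~ w)) /\ M1 (t + s).+1 w = stS nE r]).
  by apply: pr_iff => w; split=> [[[? ?] [? ?]]|[[_ [? [? ?]]] ?]].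
rewrite (exit_from mM1 measurableT MK1)//; congr (_ * _).
by apply: pr_iff => w; split=> [[[_ ?] ?]|[? ?]].
Qed.

Lemma mass_E t i :
  pr [set w | stay E 0 t (M1^~ w) /\ M1 t w = stE nS i] = (alpha *m P ^+ t) 0 i.
Proof.
rewrite total_init; last first.
  apply: measurable_conj (mM1 _ _).
  by have := measurable_cyl mM1 (@upto_stay _ E 0 t).
rewrite mxE; apply: eq_bigr => k _; rewrite -init_stE.
transitivity (pr [set w | (setT w /\ setT (M1^~ w) /\ M1 0%N w = stE nS k /\
    stay E 0 t (M1^~ w)) /\ M1 (0 + t)%N w = stE nS i]).
  by apply: pr_iff => w; split=> [[[? ?] ?]|[[_ [_ [? ?]]] ?]].
rewrite (stay_inE mM1 measurableT MK1)//; congr (_ * _).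
by apply: pr_iff => w; split=> [[_]|].
Qed.

Lemma M1_step t F x y : upto t F ->
  pr [set w | F (M1^~ w) /\ M1 t w = x /\ M1 t.+1 w = y] =
  pr [set w | F (M1^~ w) /\ M1 t w = x] * kern P U Q1 x y.
Proof.
move=> uF.
transitivity (pr [set w | (setT w /\ F (M1^~ w)) /\ M1 t w = x /\ M1 t.+1 w = y]).
  by apply: pr_iff => w; split=> [[? ?]|[[_ ?] ?]].
rewrite (markov_cyl mM1 measurableT MK1)//; congr (_ * _).
by apply: pr_iff => w; split=> [[[_ ?] ?]|[? ?]].
Qed.

Lemma mass_start s r i :
  pr [set w | leaves s r (M1^~ w) /\ M1 0%N w = stE nS i] =
  alpha 0 i * (P ^+ s *m U) i r.
Proof.
rewrite -init_stE.
transitivity (pr [set w | (setT (M1^~ w) /\ M1 0%N w = stE nS i) /\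
    (stay E 0 s (M1^~ w) /\ M1 (0 + s).+1 w = stS nE r)]).
  by apply: pr_iff => w; split=> [[[? ?] ?]|[[_ ?] [? ?]]].
rewrite M1_exit_from//; congr (_ * _).
by apply: pr_iff => w; split=> [[_]|].
Qed.

Lemma mass_leaves s r :
  pr [set w | leaves s r (M1^~ w)] = (alpha *m P ^+ s *m U) 0 r.
Proof.
rewrite total_init; last exact: measurable_leaves.
by rewrite -mulmxA mxE; apply: eq_bigr => i _; exact: mass_start.
Qed.

Lemma leavesE s r x t i : leaves s r x -> x t = stE nS i -> (s < t)%N ->
  ~~ E (x s.+1) /\ ~~ ~~ E (x t).
Proof. by move=> [_ ->] ->; rewrite inE_setS inE_setE. Qed.

Lemma reenter_null s t : (s <= t)%N ->
  pr [set w | setT w /\ (~~ E (M1 s w) /\ ~~ ~~ E (M1 t w))] = 0.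
Proof. exact: (outE_null mM1 measurableT MK1). Qed.

Lemma measurable_reenter s t :
  measurable [set w | setT w /\ (~~ E (M1 s w) /\ ~~ ~~ E (M1 t w))].
Proof.
have m1 := @measurable_fin _ _ _ (M1 s) (fun x => ~~ E x) (mM1 s).
have m2 := @measurable_fin _ _ _ (M1 t) (fun x => ~~ ~~ E x) (mM1 t).
exact: measurable_conj measurableT (measurable_conj m1 m2).
Qed.

(** Confined to E up to t, then the jump to j, then the exit from j after
s - t more steps.  If s <= t the chain would be in E after having left it. *)
Lemma mass_jumpEE s r t i j :
  pr [set w | leaves s r (M1^~ w) /\ (M1 t w = stE nS i /\ M1 t.+1 w = stE nS j)] =
  (t < s)%:R * ((alpha *m P ^+ t) 0 i * P i j * (P ^+ (s - t.+1) *m U) j r).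
Proof.
have mA : measurable [set w | leaves s r (M1^~ w) /\
    (M1 t w = stE nS i /\ M1 t.+1 w = stE nS j)].
  apply: measurable_conj; first exact: measurable_leaves.
  exact: measurable_conj (mM1 _ _) (mM1 _ _).
have [ts|st] := ltnP t s; last first.
  rewrite mul0r; apply: (pr_null mA _ _ (@reenter_null s.+1 t.+1 _)) => //.
    exact: measurable_reenter.
  by move=> w [Lw [_ Mj]]; split=> //; exact: leavesE Lw Mj _.
rewrite mul1r -(kernEE P U Q1) -mass_E -(M1_step _ _ (@upto_stay _ E 0 t)).
pose F := [set x : nat -> option 'I_(nE + nS) | stay E 0 t x /\ x t = stE nS i].
have uF : upto t.+1 F.
  move=> x x' xx' [xE xi]; split; last by rewrite -xx'.
  by apply: upto_stay xE => u ut; apply: xx'; exact: leqW.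
transitivity (pr [set w | F (M1^~ w) /\ M1 t.+1 w = stE nS j] *
    (P ^+ (s - t.+1) *m U) j r); last first.
  by congr (_ * _); apply: pr_iff => w; split=> [[[? ?] ?]|[? [? ?]]].
rewrite -M1_exit_from//; apply: pr_iff => w; rewrite subnKC//.
split=> [[[sE sr] [Mi Mj]]|[[[tE Mi] Mj] [sE sr]]].
  split; first by split=> //; split=> // u us; apply: sE; lia.
  by split=> // u us; apply: sE; lia.
split=> //; split=> // u us; have [ut|ut] := leqP u t.
  by apply: tE; lia.
by apply: sE; lia.
Qed.

(** The only jump from E to S is the exit. *)
Lemma mass_jumpES s r t i j :
  pr [set w | leaves s r (M1^~ w) /\ (M1 t w = stE nS i /\ M1 t.+1 w = stS nE j)] =
  ((t == s) && (r == j))%:R * ((alpha *m P ^+ t) 0 i * U i j).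
Proof.
have mA : measurable [set w | leaves s r (M1^~ w) /\
    (M1 t w = stE nS i /\ M1 t.+1 w = stS nE j)].
  apply: measurable_conj; first exact: measurable_leaves.
  exact: measurable_conj (mM1 _ _) (mM1 _ _).
have [ts|st|->] := ltngtP t s; rewrite ?mul0r /=.
- apply: pr_empty => w [[sE _] [_ Mj]].
  by have := sE t.+1; rewrite Mj inE_setS add0n => /(_ ts).
- apply: (pr_null mA _ _ (@reenter_null s.+1 t st)); first exact: measurable_reenter.
  by move=> w [Lw [Mi _]]; split=> //; exact: leavesE Lw Mi _.
have [->|rj] := eqVneq r j; last first.
  rewrite mul0r; apply: pr_empty => w [[_ ->] [_ /stS_inj]] rj'.
  by rewrite rj' eqxx in rj.
rewrite mul1r -(kernES P U Q1) -mass_E -(M1_step _ _ (@upto_stay _ E 0 s)).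
by apply: pr_iff => w; split=> [[[? ?] [? ?]]|[? [? ?]]].
Qed.

(** * Observed termination times *)

Definition obs a b w := term_time M1 w = Some a /\ term_time M2 w = Some b.

Lemma term_timeP (X : nat -> T -> option 'I_(nE + nS)) n w :
  term_time X w = Some n <-> first_at (fun x => x == None) n (X^~ w).
Proof. exact: first_timeP. Qed.

Lemma measurable_term (X : nat -> T -> option 'I_(nE + nS)) n :
  measurable_process X -> measurable [set w | term_time X w = Some n].
Proof.
move=> mX.
have := measurable_cyl mX (@upto_first_at _ (fun x => x == None) n).
by congr measurable; apply/seteqP; split=> w /=; rewrite term_timeP.
Qed.

Lemma measurable_obs a b : measurable [set w | obs a b w].
Proof. exact: measurable_conj (measurable_term a mM1) (measurable_term b mM2). Qed.

Lemma M2_leaves s r w t : leaves s r (M1^~ w) -> (t <= s.+1)%N -> M2 t w = M1 t w.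
Proof. by move=> Lw ts; rewrite (cp_agree hp)// (leaves_exit_time Lw). Qed.

(** Up to its exit time M1 is alive, and so is M2, which coincides with M1 until
then: the termination time is that of the future, shifted. *)
Lemma term_hits (X : nat -> T -> option 'I_(nE + nS)) s r n w :
  (s.+1 < n)%N -> leaves s r (M1^~ w) ->
  (forall t, (t <= s.+1)%N -> X t w = M1 t w) ->
  term_time X w = Some n <-> hits None (n - s.+1) (after s.+1 (X^~ w)).
Proof.
move=> sn [sE sr] XM; rewrite term_timeP /hits /after subnKC 1?ltnW//.
split=> [[n0 /eqP Xn Xu]|[Xu Xn]].
  by split=> // u un; apply/eqP/Xu; lia.
split; [by lia | exact/eqP |] => u /andP[u0 un]; apply/eqP.
have [us|us] := leqP u s.+1; last first.
  by rewrite -(subnKC (ltnW us)); apply: Xu; lia.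
rewrite XM//; move: us; rewrite leq_eqVlt => /orP[/eqP ->|us]; first by rewrite sr.
by move=> M0; have := sE u; rewrite M0 inE_set0 add0n => /(_ us).
Qed.

Lemma obs_hits s r a b w : (s.+1 < a)%N -> (s.+1 < b)%N -> leaves s r (M1^~ w) ->
  obs a b w <-> hits None (a - s.+1) (after s.+1 (M1^~ w)) /\
                hits None (b - s.+1) (after s.+1 (M2^~ w)).
Proof.
move=> sa sb Lw; rewrite /obs (term_hits sa Lw)// (term_hits sb Lw)//.
by move=> t; exact: M2_leaves Lw.
Qed.

(** M1 terminates from S only, hence after the exit time. *)
Lemma exit_None_null s :
  pr [set w | stay E 0 s (M1^~ w) /\ M1 s.+1 w = None] = 0.
Proof.
have mA : measurable [set w | stay E 0 s (M1^~ w) /\ M1 s.+1 w = None].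
  by have := measurable_conj (measurable_cyl mM1 (@upto_stay _ E 0 s)) (mM1 s.+1 None).
apply: (total_prob0 mA (mM1 s)) => x.
have : pr [set w | stay E 0 s (M1^~ w) /\ M1 s w = x /\ M1 s.+1 w = None] = 0.
  case: (stateP x) => [i|r|].
  - by rewrite (M1_step _ _ (@upto_stay _ E 0 s)) kernE0 ?mulr0.
  - by apply: pr_empty => w [sE [Ms _]]; have := sE s; rewrite Ms inE_setS add0n leqnn => /(_ isT).
  - by apply: pr_empty => w [sE [Ms _]]; have := sE s; rewrite Ms inE_set0 add0n leqnn => /(_ isT).
by move=> <-; apply: pr_iff => w; split=> [[[? ?] ?]|[? [? ?]]].
Qed.

(** Peel off the exits at times 1, 2, and so on: up to null events, after N of
them the chain is still in E at time N.  For N + 1 the smaller of a and b, one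
of the chains is absorbed at time N + 1; if it is M2, then M1 is too, since they
coincide before the exit.  So M1 would terminate from E, which is null. *)
Lemma obs_split A a b : measurable A ->
  pr [set w | A w /\ obs a b w] =
  \sum_(0 <= s < (minn a b).-1) \sum_r
    pr [set w | leaves s r (M1^~ w) /\ (A w /\ obs a b w)].
Proof.
move=> mA; have mAo := measurable_conj mA (measurable_obs a b).
pose B N := [set w | stay E 0 N (M1^~ w) /\ (A w /\ obs a b w)].
have mB N : measurable (B N).
  by have := measurable_conj (measurable_cyl mM1 (@upto_stay _ E 0 N)) mAo.
(* The next state is in E, or in S by an exit, or absorbing by a null event. *)
have step N : pr (B N) = pr (B N.+1) +
    \sum_r pr [set w | leaves N r (M1^~ w) /\ (A w /\ obs a b w)].
  rewrite (total_prob Pr (mB N) (mM1 N.+1)) sum_state.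
  rewrite [X in X + _](pr_null _ _ _ (exit_None_null N)); last 3 first.
  - exact: measurable_conj (mB N) (mM1 _ _).
  - by have := measurable_conj (measurable_cyl mM1 (@upto_stay _ E 0 N)) (mM1 N.+1 None).
  - by move=> w [[? _] ?].
  rewrite add0r; congr (_ + _).
    rewrite (total_prob Pr (mB N.+1) (mM1 N.+1)) sum_state.
    rewrite [X in _ = X + _]pr_empty ?add0r; last first.
      move=> w [[sE _] M0]; have := sE N.+1.
      by rewrite M0 inE_set0 add0n leqnn => /(_ isT).
    rewrite [X in _ = _ + X]big1 ?addr0; last first.
      move=> r _; apply: pr_empty => w [[sE _] MS]; have := sE N.+1.
      by rewrite MS inE_setS add0n leqnn => /(_ isT).
    apply: eq_bigr => e _; apply: pr_iff => w; split=> [[[sE Ao] Me]|[[sE Ao] Me]].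
      split=> //; split=> // u; rewrite add0n => /andP[_].
      by rewrite leq_eqVlt => /orP[/eqP ->|us]; [rewrite Me inE_setE | exact: sE].
    by split=> //; split=> // u us; apply: sE; lia.
  by apply: eq_bigr => r _; apply: pr_iff => w; split=> [[[? ?] ?]|[[? ?] ?]].
have sumB N : pr [set w | A w /\ obs a b w] = pr (B N) +
   \sum_(0 <= s < N) \sum_r pr [set w | leaves s r (M1^~ w) /\ (A w /\ obs a b w)].
  elim: N => [|N ->]; last first.
    by rewrite big_nat_recr//= step addrAC -!addrA [X in _ + X]addrC.
  rewrite big_geq// addr0 (total_prob Pr mAo (mM1 0%N)) sum_state.
  rewrite (total_prob Pr (mB 0%N) (mM1 0%N)) sum_state.
  have n0 x : ~~ E x ->
      pr [set w | (A w /\ obs a b w) /\ M1 0%N w = x] = pr [set w | B 0%N w /\ M1 0%N w = x].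
    move=> nEx; rewrite [RHS]pr_empty; last first.
      by move=> w [[sE _] M0]; have := sE 0%N isT; rewrite M0 (negbTE nEx).
    have mn0 := @measurable_fin _ _ _ (M1 0%N) (fun x => ~~ E x) (mM1 0%N).
    apply: (pr_null _ mn0 _ init_notE); last by move=> w [_ /= ->].
    exact: measurable_conj mAo (mM1 _ _).
  rewrite !n0 ?inE_set0//; congr (_ + (_ + _)).
    apply: eq_bigr => e _; apply: pr_iff => w; split=> [[Ao Me]|[[_ Ao] Me]//].
    by split=> //; split=> // u; rewrite add0n leqn0 => /eqP ->; rewrite Me inE_setE.
  by apply: eq_bigr => r _; rewrite n0// inE_setS.
rewrite (sumB (minn a b).-1) [X in X + _](_ : _ = 0) ?add0r//.
set N := (minn a b).-1.
have mBN := mB N.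
have mex := measurable_conj (measurable_cyl mM1 (@upto_stay _ E 0 N)) (mM1 N.+1 None).
apply: (pr_null mBN mex _ (exit_None_null N))
  => w [sE [_ [/term_timeP[a0 /eqP Ma _] /term_timeP[b0 /eqP Mb _]]]].
split=> //.
have N1 : N.+1 = minn a b by rewrite /N prednK// leq_min a0 b0.
rewrite N1; have [//|ba] := leqP a b.
rewrite -Mb (cp_agree hp)//.
case et: (exit_time M1 w) => [e|//] /=.
have /exit_timeP[e0 nEe _] := et.
rewrite leqNgt; apply: contraNN nEe => eb.
by apply: sE; rewrite /N (minn_idPr (ltnW ba)); lia.
Qed.
End PairFormulas.

(** * Joint laws of jumps and termination times *)

Lemma mpow_pos (R : realType) k (A : 'M[R]_k) n (z : int) : z = n%:Z -> mpow A z = A ^+ n.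
Proof. by move=> ->. Qed.

Lemma surv0 (R : realType) nS (Q : 'M[R]_nS) n l r : (n <= l)%N -> surv Q n l r = 0.
Proof.
move=> nl; rewrite /surv (_ : n%:Z - l%:Z - 1 = Negz (l - n)); last by lia.
by rewrite /= mul0mx mxE.
Qed.

(** Reconciles the two ranges of exit times: before both terminations, and
before the jump; the terms outside the common range vanish. *)
Lemma sum_nat_cut (V : pzSemiRingType) (F : nat -> V) N t :
  (forall s, (N <= s < t)%N -> F s = 0) ->
  \sum_(0 <= s < N) (s < t)%:R * F s = \sum_(0 <= s < t) F s.
Proof.
move=> F0; rewrite (@big_nat_widen _ _ _ 0 N (maxn N t)) ?leq_maxl//.
rewrite (@big_nat_widen _ _ _ 0 t (maxn N t)) ?leq_maxr//.
rewrite big_mkcond [RHS]big_mkcond/=; apply: eq_bigr => s _.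
have [sN|Ns] := ltnP s N; have [st|ts] := ltnP s t; rewrite ?mul1r ?mul0r//.
by rewrite F0// Ns.
Qed.

Section PmfExpr.
Context (R : realType) (nE nS : nat) (P : 'M[R]_nE) (U : 'M[R]_(nE, nS))
  (Q1 Q2 : 'M[R]_nS).

Lemma pmf_exprE (v : 'rV[R]_nE) a b : pmf_expr v P U Q1 Q2 a b =
  \sum_(0 <= s < (minn a b).-1) \sum_r
    (v *m P ^+ s *m U) 0 r * (surv Q1 a s.+1 r * surv Q2 b s.+1 r).
Proof.
rewrite /pmf_expr big_add1; apply: eq_bigr => s _.
rewrite (@mpow_pos _ _ P s); last by lia.
rewrite mxE; apply: eq_bigr => r _; rewrite /odot /surv; congr (_ * _).
by rewrite mxE.
Qed.

(** The sum is empty unless a and b are at least 2, so that the case distinction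
of the definition disappears. *)
Lemma pmf_fromE a b i : pmf_from P U Q1 Q2 a b i =
  \sum_(0 <= s < (minn a b).-1) \sum_r
    (P ^+ s *m U) i r * (surv Q1 a s.+1 r * surv Q2 b s.+1 r).
Proof.
rewrite /pmf_from pmf_exprE; case: ifPn => [_|ab].
  apply: eq_bigr => s _; apply: eq_bigr => r _; congr (_ * _).
  by rewrite -mulmxA -rowE mxE.
rewrite big_geq//; lia.
Qed.
End PmfExpr.

Section PairLaws.
Context d (T : measurableType d) (R : realType) (Pr : probability T R).
Context (nE nS : nat) (alpha : 'rV[R]_nE) (P : 'M[R]_nE) (U : 'M[R]_(nE, nS))
  (Q1 Q2 : 'M[R]_nS) (M1 M2 : nat -> T -> option 'I_(nE + nS)).
Hypotheses (hpar : params_ok alpha P U Q1 Q2)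
  (hp : chain_pair Pr alpha P U Q1 Q2 M1 M2).
Local Notation pr := (prob Pr).
Local Notation obs := (obs M1 M2).

Let mM1 : measurable_process M1 := tc_meas (cp_M1 hp).
Let mM2 : measurable_process M2 := cp_M2_meas hp.

Definition jump (X : nat -> T -> option 'I_(nE + nS)) t x y w := X t w = x /\ X t.+1 w = y.

Lemma measurable_jump X t x y : measurable_process X ->
  measurable [set w | jump X t x y w].
Proof. by move=> mX; exact: measurable_conj (mX _ _) (mX _ _). Qed.

Lemma measurable_leaves_jump s r t x y :
  measurable [set w | leaves s r (M1^~ w) /\ jump M1 t x y w].
Proof. exact: measurable_conj (measurable_leaves hp s r) (measurable_jump t x y mM1). Qed.

Lemma measurable_leaves_jump_obs s r t x y a b :
  measurable [set w | leaves s r (M1^~ w) /\ (jump M1 t x y w /\ obs a b w)].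
Proof.
exact: measurable_conj (measurable_leaves hp s r)
  (measurable_conj (measurable_jump t x y mM1) (measurable_obs hp a b)).
Qed.

Lemma past_obs F s r a b : upto s.+1 F -> (s.+1 < a)%N -> (s.+1 < b)%N ->
  pr [set w | leaves s r (M1^~ w) /\ (F (M1^~ w) /\ obs a b w)] =
  pr [set w | leaves s r (M1^~ w) /\ F (M1^~ w)] *
    (surv Q1 a s.+1 r * surv Q2 b s.+1 r).
Proof.
move=> uF sa sb.
rewrite -(split_exit hp (C1 := hits None (a - s.+1)) (C2 := hits None (b - s.+1)) uF
  (@upto_hits _ _ _) (@upto_hits _ _ _)).
- by apply: pr_iff => w;
    split=> [[Lw [Fw /(obs_hits hp sa sb Lw)]]//|[[Lw Fw] /(obs_hits hp sa sb Lw)]].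
- by move=> x xl; apply: (past_life hp mM1 (M1_future hp _ _) (fun _ pw => past_M1 hp pw))
    => //; exact: ltnW.
- by move=> x xl; apply: (past_life hp mM2 (M2_future hp _ _) (fun _ pw => past_M2 hp pw))
    => //; exact: ltnW.
Qed.

Lemma upto_hits_jump n t (x y : option 'I_(nE + nS)) : upto (maxn n t.+1)
  (fun z => hits None n z /\ z t = x /\ z t.+1 = y).
Proof.
move=> z z' zz' [hz [zx zy]]; split; last first.
  by rewrite -!zz'// leq_max ?leqnSn ?leqnn ?orbT// ltnW ?orbT// leq_max leqnn orbT.
by apply: upto_hits hz => u un; apply: zz'; rewrite leq_max un.
Qed.

(** [split_exit] for an event of the first future: v is the weight of a jump of
M1 together with its termination time; M2 contributes its lifetime only. *)
Lemma jump1_obs s r a b t x y v : (s.+1 < a)%N -> (s.+1 < b)%N -> (s < t)%N ->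
  (forall z, z s.+1 = stS nE r ->
    pr [set w | past_upto M1 s.+1 z w /\
      (hits None (a - s.+1) (after s.+1 (M1^~ w)) /\
       after s.+1 (M1^~ w) (t - s.+1)%N = x /\ after s.+1 (M1^~ w) (t - s.+1).+1 = y)] =
    pr (past_upto M1 s.+1 z) * v) ->
  pr [set w | leaves s r (M1^~ w) /\ (jump M1 t x y w /\ obs a b w)] =
  (alpha *m P ^+ s *m U) 0 r * (v * surv Q2 b s.+1 r).
Proof.
move=> sa sb st Cv; rewrite -(mass_leaves hpar hp).
transitivity (pr [set w | leaves s r (M1^~ w) /\ setT (M1^~ w)] * (v * surv Q2 b s.+1 r));
  last by congr (_ * _); apply: pr_iff => w; split=> [[]|].
rewrite -(split_exit hp (C2 := hits None (b - s.+1)) (@uptoT _ s.+1)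
  (@upto_hits_jump (a - s.+1) (t - s.+1) x y) (@upto_hits _ _ _) Cv).
  apply: pr_iff => w; rewrite /after addnS subnKC// /jump.
  split=> [[Lw [J /(obs_hits hp sa sb Lw)[? ?]]]//|[[Lw _] [[h1 J] h2]]].
  by split=> //; split=> //; apply/(obs_hits hp sa sb Lw).
by move=> z zl; apply: (past_life hp mM2 (M2_future hp _ _) (fun _ pw => past_M2 hp pw))
    => //; exact: ltnW.
Qed.

Lemma jump2_obs s r a b t x y v : (s.+1 < a)%N -> (s.+1 < b)%N -> (s < t)%N ->
  (forall z, z s.+1 = stS nE r ->
    pr [set w | past_upto M1 s.+1 z w /\
      (hits None (b - s.+1) (after s.+1 (M2^~ w)) /\
       after s.+1 (M2^~ w) (t - s.+1)%N = x /\ after s.+1 (M2^~ w) (t - s.+1).+1 = y)] =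
    pr (past_upto M1 s.+1 z) * v) ->
  pr [set w | leaves s r (M1^~ w) /\ (jump M2 t x y w /\ obs a b w)] =
  (alpha *m P ^+ s *m U) 0 r * (v * surv Q1 a s.+1 r).
Proof.
move=> sa sb st Cv; rewrite -(mass_leaves hpar hp) [v * _]mulrC.
transitivity (pr [set w | leaves s r (M1^~ w) /\ setT (M1^~ w)] * (surv Q1 a s.+1 r * v));
  last by congr (_ * _); apply: pr_iff => w; split=> [[]|].
rewrite -(split_exit hp (C1 := hits None (a - s.+1)) (@uptoT _ s.+1) (@upto_hits _ _ _)
  (@upto_hits_jump (b - s.+1) (t - s.+1) x y) _ Cv).
  apply: pr_iff => w; rewrite /after addnS subnKC// /jump.
  split=> [[Lw [J /(obs_hits hp sa sb Lw)[? ?]]]//|[[Lw _] [h1 [h2 J]]]].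
  by split=> //; split=> //; apply/(obs_hits hp sa sb Lw).
by move=> z zl; apply: (past_life hp mM1 (M1_future hp _ _) (fun _ pw => past_M1 hp pw))
    => //; exact: ltnW.
Qed.

(** No jump from S takes place before the exit. *)
Lemma jumpS_early X s r t i y : (t <= s)%N ->
  (forall w, leaves s r (M1^~ w) -> X t w = M1 t w) ->
  forall w, leaves s r (M1^~ w) -> jump X t (stS nE i) y w -> False.
Proof.
move=> ts XM w Lw [Xi _]; have [sE _] := Lw.
by have := sE t; rewrite -XM// Xi inE_setS add0n => /(_ ts).
Qed.

Lemma pr_obs a b : pr [set w | obs a b w] = pmf_expr alpha P U Q1 Q2 a b.
Proof.
transitivity (pr [set w | setT w /\ obs a b w]).
  by apply: pr_iff => w; split=> [|[]].
rewrite (obs_split hpar hp)// pmf_exprE; apply: eq_big_nat => s /andP[_ sN].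
apply: eq_bigr => r _; rewrite -(mass_leaves hpar hp).
transitivity (pr [set w | leaves s r (M1^~ w) /\ setT (M1^~ w)] *
    (surv Q1 a s.+1 r * surv Q2 b s.+1 r)).
  by rewrite -past_obs//; lia.
by congr (_ * _); apply: pr_iff => w; split=> [[]|].
Qed.

Lemma pr_start a b i : pr [set w | M1 0%N w = stE nS i /\ obs a b w] =
  alpha 0 i * pmf_from P U Q1 Q2 a b i.
Proof.
rewrite (obs_split hpar hp)//; last exact: mM1.
rewrite pmf_fromE mulr_sumr; apply: eq_big_nat => s /andP[_ sN].
rewrite mulr_sumr; apply: eq_bigr => r _.
rewrite mulrA -(mass_start hp) -(past_obs (F := fun x => x 0%N = stE nS i))//; [|lia|lia].
by move=> x x' <-.
Qed.

(** Only exit times after the jump contribute.  Counted from the jump they give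
the mass function for the initial state j with both times shortened. *)
Lemma pr_jumpEE a b t i j :
  pr [set w | jump M1 t (stE nS i) (stE nS j) w /\ obs a b w] =
  (alpha *m P ^+ t) 0 i * P i j * pmf_from P U Q1 Q2 (a - t.+1) (b - t.+1) j.
Proof.
rewrite (obs_split hpar hp)//; last exact: measurable_jump.
transitivity (\sum_(0 <= s < (minn a b).-1 | (t < s)%N) \sum_r
    (alpha *m P ^+ t) 0 i * P i j * ((P ^+ (s - t.+1) *m U) j r *
    (surv Q1 a s.+1 r * surv Q2 b s.+1 r))).
  rewrite [RHS]big_mkcond; apply: eq_big_nat => s /andP[_ sN].
  have mass r := mass_jumpEE hpar hp s r t i j.
  have [ts|st] := ltnP t s; rewrite ?ts ?[(t < s)%N]ltnNge ?st/= in mass *.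
    apply: eq_bigr => r _.
    rewrite mulrA -[X in X * _]mul1r -mass.
    rewrite -(past_obs (F := fun x => x t = stE nS i /\ x t.+1 = stE nS j))//; [|lia|lia].
    by move=> x x' xx'; rewrite !xx'//; lia.
  rewrite big1// => r _; have := mass r; rewrite mul0r; apply: pr_null.
  - exact: measurable_leaves_jump_obs.
  - exact: measurable_leaves_jump.
  - by move=> w [? []].
have [tN|Nt] := leqP (minn a b).-1 t.+1.
  rewrite pmf_fromE [in RHS]big_geq; last by lia.
  rewrite mulr0 big_nat_cond big_pred0// => s; apply/negP => /andP[/andP[_ ?] ?]; lia.
rewrite -(@big_nat_widenl _ _ _ t.+1 0 _ xpredT)//.
rewrite pmf_fromE mulr_sumr -{1}[t.+1]add0n big_addn.
rewrite (_ : (minn (a - t.+1) (b - t.+1)).-1 = ((minn a b).-1 - t.+1)%N); last by lia.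
apply: eq_big_nat => s /andP[_ sN]; rewrite mulr_sumr; apply: eq_bigr => r _.
rewrite addnK; congr (_ * (_ * (_ * _))); rewrite /surv;
  congr ((mpow _ _ *m _) _ _); lia.
Qed.

Lemma pr_jumpES a b t i j :
  pr [set w | jump M1 t (stE nS i) (stS nE j) w /\ obs a b w] =
  (alpha *m P ^+ t) 0 i * U i j * surv Q1 a t.+1 j * surv Q2 b t.+1 j.
Proof.
rewrite (obs_split hpar hp)//; last exact: measurable_jump.
transitivity (\sum_(0 <= s < (minn a b).-1 | s == t) \sum_(r | r == j)
    (alpha *m P ^+ t) 0 i * U i j * (surv Q1 a s.+1 r * surv Q2 b s.+1 r)).
  rewrite [RHS]big_mkcond; apply: eq_big_nat => s /andP[_ sN].
  have mass r := mass_jumpES hpar hp s r t i j.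
  have [ts|ts] := eqVneq s t.
    rewrite [RHS]big_mkcond; apply: eq_bigr => r _.
    rewrite (past_obs (F := fun x => x t = stE nS i /\ x t.+1 = stS nE j))//;
      [|by move=> x x' xx'; rewrite !xx' ?ts|lia|lia].
    by rewrite mass ts eqxx /=; case: eqP; rewrite ?mul1r ?mul0r.
  rewrite big1// => r _; have := mass r; rewrite eq_sym (negbTE ts) mul0r; apply: pr_null.
  - exact: measurable_leaves_jump_obs.
  - exact: measurable_leaves_jump.
  - by move=> w [? []].
have [Nt|tN] := leqP (minn a b).-1 t.
  rewrite big_nat_cond big_pred0; last by move=> s; apply/negP => /andP[/andP[_ ?] /eqP ?]; lia.
  have [at1|at1] := leqP a t.+1; first by rewrite [surv Q1 _ _ _]surv0// mulr0 mul0r.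
  by rewrite [surv Q2 _ _ _]surv0 ?mulr0//; lia.
rewrite big_mkcond (bigD1_seq t) ?mem_index_iota ?iota_uniq//= eqxx.
rewrite [X in _ + X]big1 ?addr0; last by move=> s st; rewrite (negbTE st).
by rewrite big_pred1_eq !mulrA.
Qed.

Lemma pr_jumpSS1 a b t i j :
  pr [set w | jump M1 t (stS nE i) (stS nE j) w /\ obs a b w] =
  \sum_(0 <= s < t) \sum_r (alpha *m P ^+ s *m U) 0 r * (Q1 ^+ (t - s.+1)) r i
     * Q1 i j * surv Q1 a t.+1 j * surv Q2 b s.+1 r.
Proof.
rewrite (obs_split hpar hp)//; last exact: measurable_jump.
rewrite -[RHS](@sum_nat_cut _ _ (minn a b).-1); last first.
  move=> s st; rewrite big1// => r _; have [as1|as1] := leqP a s.+1.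
    by rewrite [surv Q1 _ _ _]surv0 ?mulr0 ?mul0r//; lia.
  by rewrite [surv Q2 _ _ _]surv0 ?mulr0//; lia.
apply: eq_big_nat => s /andP[_ sN]; have [st|ts] := ltnP s t; last first.
  rewrite mul0r big1// => r _; apply: pr_empty => w [Lw [J _]].
  by apply: (jumpS_early ts _ Lw J).
rewrite mul1r; apply: eq_bigr => r _.
rewrite (jump1_obs (v := (Q1 ^+ (t - s.+1)) r i * Q1 i j * surv Q1 a t.+1 j))//; [|lia|lia|].
  by rewrite !mulrA.
by move=> z zs; apply: (past_jump hp mM1 (M1_future hp _ _) (fun _ pw => past_M1 hp pw)) => //; lia.
Qed.

Lemma pr_jumpSS2 a b t i j :
  pr [set w | jump M2 t (stS nE i) (stS nE j) w /\ obs a b w] =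
  \sum_(0 <= s < t) \sum_r (alpha *m P ^+ s *m U) 0 r * (Q2 ^+ (t - s.+1)) r i
     * Q2 i j * surv Q2 b t.+1 j * surv Q1 a s.+1 r.
Proof.
rewrite (obs_split hpar hp)//; last exact: measurable_jump.
rewrite -[RHS](@sum_nat_cut _ _ (minn a b).-1); last first.
  move=> s st; rewrite big1// => r _; have [as1|as1] := leqP a s.+1.
    by rewrite [surv Q1 _ _ _]surv0 ?mulr0.
  by rewrite [surv Q2 _ _ _]surv0 ?mulr0 ?mul0r//; lia.
apply: eq_big_nat => s /andP[_ sN]; have [st|ts] := ltnP s t; last first.
  rewrite mul0r big1// => r _; apply: pr_empty => w [Lw [J _]].
  apply: (jumpS_early ts _ Lw J) => w' Lw'.
  by apply: (M2_leaves hp Lw'); exact: leqW.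
rewrite mul1r; apply: eq_bigr => r _.
rewrite (jump2_obs (v := (Q2 ^+ (t - s.+1)) r i * Q2 i j * surv Q2 b t.+1 j))//; [|lia|lia|].
  by rewrite !mulrA.
by move=> z zs; apply: (past_jump hp mM2 (M2_future hp _ _) (fun _ pw => past_M2 hp pw)) => //; lia.
Qed.

Lemma pr_jumpS01 a b t i :
  pr [set w | jump M1 t (stS nE i) None w /\ obs a b w] =
  \sum_(0 <= s < t) \sum_r (t.+1 == a)%:R * (alpha *m P ^+ s *m U) 0 r *
     (Q1 ^+ (t - s.+1)) r i * exitv Q1 i 0 * surv Q2 b s.+1 r.
Proof.
rewrite (obs_split hpar hp)//; last exact: measurable_jump.
rewrite -[RHS](@sum_nat_cut _ _ (minn a b).-1); last first.
  move=> s st; rewrite big1// => r _; have [as1|as1] := leqP a s.+1.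
    by rewrite (_ : _ == _ = false) ?mul0r//; lia.
  by rewrite [surv Q2 _ _ _]surv0 ?mulr0//; lia.
apply: eq_big_nat => s /andP[_ sN]; have [st|ts] := ltnP s t; last first.
  rewrite mul0r big1// => r _; apply: pr_empty => w [Lw [J _]].
  by apply: (jumpS_early ts _ Lw J).
rewrite mul1r; apply: eq_bigr => r _.
rewrite (jump1_obs (v := (t.+1 == a)%:R * (Q1 ^+ (t - s.+1)) r i * exitv Q1 i 0))//; [|lia|lia|].
  by ring.
by move=> z zs; apply: (past_end hp mM1 (M1_future hp _ _) (fun _ pw => past_M1 hp pw)) => //; lia.
Qed.

Lemma pr_jumpS02 a b t i :
  pr [set w | jump M2 t (stS nE i) None w /\ obs a b w] =
  \sum_(0 <= s < t) \sum_r (t.+1 == b)%:R * (alpha *m P ^+ s *m U) 0 r *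
     (Q2 ^+ (t - s.+1)) r i * exitv Q2 i 0 * surv Q1 a s.+1 r.
Proof.
rewrite (obs_split hpar hp)//; last exact: measurable_jump.
rewrite -[RHS](@sum_nat_cut _ _ (minn a b).-1); last first.
  move=> s st; rewrite big1// => r _; have [as1|as1] := leqP a s.+1.
    by rewrite [surv Q1 _ _ _]surv0 ?mulr0.
  by rewrite (_ : _ == _ = false) ?mul0r//; lia.
apply: eq_big_nat => s /andP[_ sN]; have [st|ts] := ltnP s t; last first.
  rewrite mul0r big1// => r _; apply: pr_empty => w [Lw [J _]].
  apply: (jumpS_early ts _ Lw J) => w' Lw'.
  by apply: (M2_leaves hp Lw'); exact: leqW.
rewrite mul1r; apply: eq_bigr => r _.
rewrite (jump2_obs (v := (t.+1 == b)%:R * (Q2 ^+ (t - s.+1)) r i * exitv Q2 i 0))//; [|lia|lia|].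
  by ring.
by move=> z zs; apply: (past_end hp mM2 (M2_future hp _ _) (fun _ pw => past_M2 hp pw)) => //; lia.
Qed.
End PairLaws.

(** Statistics count jumps from time t, the formulas index them by the arrival
time t + 1; a range that starts at 2 skips a zero term. *)
Lemma nneseries_from (R : realType) k (f : nat -> \bar R) : (0 < k)%N ->
  (forall t, 0 <= f t.+1)%E -> (forall t, (t.+1 < k)%N -> f t.+1 = 0%E) ->
  (\sum_(k <= t <oo) f t = \sum_(0 <= t <oo) f t.+1)%E.
Proof.
move=> k0 f0 fk.
pose h t : \bar R := if (k <= t)%N then f t else 0%E.
have h0 t : (0 <= h t)%E.
  by rewrite /h; case: ifPn => // kt; move: (leq_trans k0 kt); case: t kt.
have hf t : h t.+1 = f t.+1.
  by rewrite /h; case: ifPn => //; rewrite -ltnNge => /fk.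
rewrite eseries_cond eseries_mkcond /=.
transitivity (\sum_(0 <= t <oo) h t)%E; first exact: eq_eseriesr.
rewrite nneseries_recl// {1}/h leqNgt k0 /= add0e -nneseries_addn//.
by apply: eq_eseriesr => t _; rewrite addn1.
Qed.

(** * Independent copies *)

Section PairSigma.
Context d (T : measurableType d) (k : nat) (M1 M2 : nat -> T -> option 'I_k).

Definition pair_gen : set (set T) := [set A | exists t x,
  A = [set w | M1 t w = x] \/ A = [set w | M2 t w = x]].

(** The sample space with the sigma-algebra of one pair: measurability of an event
in this space is membership in [pair_sigma], so the measurability lemmas above
apply to both sigma-algebras. *)
Definition pairT := g_sigma_algebraType pair_gen.

Lemma sigma_process1 : @measurable_process _ pairT k M1.
Proof. by move=> t x; apply: sub_sigma_algebra; exists t, x; left. Qed.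

Lemma sigma_process2 : @measurable_process _ pairT k M2.
Proof. by move=> t x; apply: sub_sigma_algebra; exists t, x; right. Qed.
End PairSigma.

Section Copies.
Context (R : realType) d (T : measurableType d) (Pr : probability T R).
Context (nE nS n : nat) (alpha : 'rV[R]_nE) (P : 'M[R]_nE) (U : 'M[R]_(nE, nS))
  (Q1 Q2 : 'M[R]_nS) (M1 M2 : 'I_n -> nat -> T -> option 'I_(nE + nS))
  (n1 n2 : 'I_n -> nat).
Hypotheses (hpar : params_ok alpha P U Q1 Q2)
  (hpair : forall m, chain_pair Pr alpha P U Q1 Q2 (M1 m) (M2 m))
  (hindep : indep_sigmas Pr (fun m => pair_sigma (M1 m) (M2 m)))
  (hpos : forall m, 0 < joint_pmf Pr (M1 m) (M2 m) (n1 m) (n2 m)).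
Local Notation pr := (prob Pr).
Local Notation xi := (observed M1 M2 n1 n2).
Local Notation f m := (joint_pmf Pr (M1 m) (M2 m) (n1 m) (n2 m)).
Local Notation obsm m := [set w | obs (M1 m) (M2 m) (n1 m) (n2 m) w].

Lemma pair_sigma_obs m : pair_sigma (M1 m) (M2 m) (obsm m).
Proof.
have := measurable_conj
  (measurable_term (n1 m) (@sigma_process1 _ _ _ (M1 m) (M2 m)))
  (measurable_term (n2 m) (@sigma_process2 _ _ _ (M1 m) (M2 m))).
by [].
Qed.

Lemma xiE : xi = \bigcap_(m in [set` [set: 'I_n]%SET]) obsm m.
Proof.
apply/seteqP; split=> w h; first by move=> m _; exact: h.
by move=> m; apply: h; rewrite /= inE.
Qed.

Lemma prod_setT (F : 'I_n -> R) : \prod_(m in [set: 'I_n]%SET) F m = \prod_m F m.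
Proof. by apply: eq_bigl => m; rewrite inE. Qed.

Lemma pr_xi : pr xi = \prod_m f m.
Proof.
rewrite xiE /prob (hindep [set: 'I_n]%SET pair_sigma_obs).
by rewrite prod_setT.
Qed.

Lemma pr_xi_gt0 : 0 < pr xi.
Proof. by rewrite pr_xi prodr_gt0. Qed.

Lemma measurable_xi : measurable xi.
Proof.
rewrite xiE; apply: fin_bigcap_measurable => [|m _]; first exact: finite_finset.
exact: (measurable_obs (hpair m)).
Qed.

(** Replace the data of the m-th copy by A and these data in the product of
independent events: all other factors are common. *)
Lemma pr_event_xi m A : pair_sigma (M1 m) (M2 m) A ->
  pr [set w | A w /\ xi w] = pr [set w | A w /\ obsm m w] / f m * pr xi.
Proof.
move=> sA.
pose B m' := if m' == m then A `&` obsm m else obsm m'.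
have sB m' : pair_sigma (M1 m') (M2 m') (B m').
  rewrite /B; case: eqP => [->|_]; last exact: pair_sigma_obs.
  have mA : @measurable _ (pairT (M1 m) (M2 m)) A by exact: sA.
  have mo : @measurable _ (pairT (M1 m) (M2 m)) (obsm m) by exact: pair_sigma_obs.
  by have := measurableI _ _ mA mo.
transitivity (pr (\bigcap_(m' in [set` [set: 'I_n]%SET]) B m')).
  apply: pr_iff => w; split=> [[Aw xw] m' _|Bw].
    by rewrite /B; case: eqP => [_|_]; [split=> //; exact: xw | exact: xw].
  have BT m' : B m' w by apply: Bw; rewrite /= inE.
  split; first by have := BT m; rewrite /B eqxx => -[].
  by move=> m'; have := BT m'; rewrite /B; case: eqP => [-> [] //|_]; exact.
rewrite pr_xi /prob hindep// prod_setT (bigD1 m)//= [in RHS](bigD1 m)//=.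
rewrite {1}/B eqxx mulrA divfK ?gt_eqF//; congr (_ * _).
by apply: eq_bigr => m' /negbTE m'm; rewrite /B m'm.
Qed.

Lemma integral_event (b : T -> bool) : measurable [set w | b w] ->
  (\int[Pr]_(w in xi) (b w)%:R%:E = (pr [set w | b w /\ xi w])%:E)%E.
Proof.
move=> mb; rewrite -prE; last exact: measurable_conj mb measurable_xi.
rewrite -(integral_indic _ measurable_xi mb); apply: eq_integral => w _.
by rewrite indicE; congr ((nat_of_bool _)%:R%:E); apply/idP/idP; rewrite inE.
Qed.

Lemma measurable_event (b : T -> bool) D : measurable [set w | b w] ->
  measurable_fun D (EFin \o (fun w => (b w)%:R : R)).
Proof.
move=> mb; apply/measurable_EFinP.
rewrite (_ : (fun w => (b w)%:R) = \1_[set w | b w]); first exact: measurable_indic.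
by apply/funext => w; rewrite indicE; congr ((nat_of_bool _)%:R); apply/idP/idP; rewrite inE.
Qed.

Lemma cexp_xi (X : T -> \bar R) (v : \bar R) :
  (\int[Pr]_(w in xi) X w = (pr xi)%:E * v)%E -> cexp Pr X xi = v.
Proof.
move=> Xv; rewrite /cexp Xv (prE _ measurable_xi) inver gt_eqF ?pr_xi_gt0//.
by rewrite muleAC -EFinM divff ?gt_eqF ?pr_xi_gt0// mul1e.
Qed.

Lemma event_measurable m (b : T -> bool) :
  pair_sigma (M1 m) (M2 m) [set w | b w] -> measurable [set w | b w].
Proof.
apply: smallest_sub; first exact: sigma_algebra_measurable.
by move=> _ [t [x [->|->]]]; [exact: (tc_meas (cp_M1 (hpair m))) | exact: (cp_M2_meas (hpair m))].
Qed.

(** Monotone convergence for the sum over t; each term is then given by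
[pr_event_xi], and the common factor, the probability of the data, cancels. *)
Lemma cexp_sum (b : 'I_n -> nat -> T -> bool) (g : 'I_n -> nat -> R) :
  (forall m t, pair_sigma (M1 m) (M2 m) [set w | b m t w]) ->
  (forall m t, pr [set w | b m t w /\ obsm m w] = g m t) ->
  cexp Pr (fun w => \sum_(m < n) \sum_(0 <= t <oo) (b m t w)%:R%:E)%E xi =
  (\sum_(m < n) \sum_(0 <= t <oo) (g m t / f m)%:E)%E.
Proof.
move=> sb gE; apply: cexp_xi.
have mb m t := event_measurable (sb m t).
rewrite ge0_integral_sum; last 3 first.
- exact: measurable_xi.
- move=> m; apply: ge0_emeasurable_sum => [t w _ _|t _]; first by rewrite lee_fin.
  exact: measurable_event.
- by move=> m w _; apply: nneseries_ge0 => t _ _; rewrite lee_fin.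
have fgt m : 0 < f m by exact: hpos.
have g0 m t : (0 <= (g m t / f m)%:E)%E.
  by rewrite lee_fin divr_ge0 ?(ltW (fgt m))// -gE; exact: pr_ge0.
rewrite ge0_sume_distrr; last by move=> m _; apply: nneseries_ge0 => t _ _.
apply: eq_bigr => m _.
rewrite integral_nneseries; last 3 first.
- exact: measurable_xi.
- by move=> t; exact: measurable_event.
- by move=> t w _; rewrite lee_fin.
rewrite -nneseriesZl//; apply: eq_eseriesr => t _.
by rewrite integral_event// (pr_event_xi (sb m t)) gE -EFinM mulrC.
Qed.

Lemma cexp_fin_sum (b : 'I_n -> T -> bool) (g : 'I_n -> R) :
  (forall m, pair_sigma (M1 m) (M2 m) [set w | b m w]) ->
  (forall m, pr [set w | b m w /\ obsm m w] = g m) ->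
  cexp Pr (fun w => \sum_(m < n) (b m w)%:R%:E)%E xi =
  (\sum_(m < n) (g m / f m)%:E)%E.
Proof.
move=> sb gE; apply: cexp_xi.
have mb m := event_measurable (sb m).
rewrite ge0_integral_sum; last 3 first.
- exact: measurable_xi.
- by move=> m; exact: measurable_event.
- by move=> m w _; rewrite lee_fin.
have fgt m : 0 < f m by exact: hpos.
rewrite ge0_sume_distrr; last first.
  by move=> m _; rewrite lee_fin divr_ge0 ?(ltW (fgt m))// -gE; exact: pr_ge0.
apply: eq_bigr => m _.
by rewrite integral_event// (pr_event_xi (sb m)) gE -EFinM mulrC.
Qed.

Section Jumps.
Variables (X : 'I_n -> nat -> T -> option 'I_(nE + nS)).
Hypothesis sX : forall m, @measurable_process _ (pairT (M1 m) (M2 m)) _ (X m).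

Lemma cexp_jumps x y (g : 'I_n -> nat -> R) :
  (forall m t, pr [set w | jump (X m) t x y w /\ obsm m w] = g m t) ->
  cexp Pr (jumps R X x y) xi =
  (\sum_(m < n) \sum_(0 <= t <oo) (g m t / f m)%:E)%E.
Proof.
move=> gE.
have bE m t w : (X m t w == x) && (X m t.+1 w == y) <-> jump (X m) t x y w.
  by split=> [/andP[/eqP ? /eqP ?]|[/eqP ? /eqP ?]]; last exact/andP.
apply: cexp_sum => [m t|m t].
  have := measurable_jump t x y (@sX m).
  by congr (pair_sigma _ _ _); apply/seteqP; split=> w /=; have [] := bE m t w.
by rewrite -gE; apply: pr_iff => w; split=> -[/bE].
Qed.

(** Shaped to match the formulas: G is the summand indexed by arrival times. *)
Lemma cexp_jumps_from k x y (g : 'I_n -> nat -> R) (G : 'I_n -> nat -> \bar R) :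
  (forall m t, pr [set w | jump (X m) t x y w /\ obsm m w] = g m t) ->
  (0 < k)%N -> (forall m t, G m t.+1 = (g m t / f m)%:E) ->
  (forall m t, (t.+1 < k)%N -> g m t = 0) ->
  cexp Pr (jumps R X x y) xi = (\sum_(m < n) \sum_(k <= t <oo) G m t)%E.
Proof.
move=> gE k0 GE gk; rewrite (cexp_jumps gE); apply: eq_bigr => m _.
rewrite nneseries_from//.
- by apply: eq_eseriesr => t _; rewrite GE.
- move=> t; rewrite GE lee_fin divr_ge0// -?gE; first exact: pr_ge0.
  exact/ltW/hpos.
- by move=> t tk; rewrite GE gk// mul0r.
Qed.
End Jumps.
End Copies.

Theorem lemma4p1 (R : realType) (d : measure_display) (T : measurableType d)
  (Pr : probability T R) (nE nS n : nat)
  (alpha : 'rV[R]_nE) (P : 'M[R]_nE) (U : 'M[R]_(nE, nS)) (Q1 Q2 : 'M[R]_nS)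
  (M1 M2 : 'I_n -> nat -> T -> option 'I_(nE + nS)) (n1 n2 : 'I_n -> nat)
  (hpar : params_ok alpha P U Q1 Q2)
  (hpair : forall m, chain_pair Pr alpha P U Q1 Q2 (M1 m) (M2 m))
  (hindep : indep_sigmas Pr (fun m => pair_sigma (M1 m) (M2 m)))
  (hpos : forall m, 0 < joint_pmf Pr (M1 m) (M2 m) (n1 m) (n2 m)) :
  let q1 := exitv Q1 in
  let q2 := exitv Q2 in
  let xi := observed M1 M2 n1 n2 in
  let f m := joint_pmf Pr (M1 m) (M2 m) in
  let fc a b j := pmf_from P U Q1 Q2 a b j in
  [/\ (forall m a b, (2 <= a)%N -> (2 <= b)%N ->
         f m a b = pmf_expr alpha P U Q1 Q2 a b),
      (forall m a b i, (2 <= a)%N -> (2 <= b)%N -> 0 < alpha 0 i ->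
         cprob Pr [set w | term_time (M1 m) w = Some a /\
                           term_time (M2 m) w = Some b]
                  [set w | M1 m 0%N w = stE nS i /\ M2 m 0%N w = stE nS i]
         = fc a b i),
      (forall i : 'I_nE,
         cexp Pr (starts R M1 (stE nS i)) xi =
         (\sum_(m < n) (alpha 0 i * fc (n1 m) (n2 m) i
                          / f m (n1 m) (n2 m))%:E)%E),
      (forall i j : 'I_nE,
         cexp Pr (jumps R M1 (stE nS i) (stE nS j)) xi =
         (\sum_(m < n) \sum_(1 <= t <oo)
            ((alpha *m mpow P (t%:Z - 1)) 0 i * P i j
             * fc (n1 m - t)%N (n2 m - t)%N j
             / f m (n1 m) (n2 m))%:E)%E)
    & [/\ (forall (i : 'I_nE) (j : 'I_nS),
         cexp Pr (jumps R M1 (stE nS i) (stS nE j)) xi =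
         (\sum_(m < n) \sum_(1 <= t <oo)
            ((alpha *m mpow P (t%:Z - 1)) 0 i * U i j
             * (mpow Q1 ((n1 m)%:Z - t%:Z - 1) *m q1) j 0
             * (mpow Q2 ((n2 m)%:Z - t%:Z - 1) *m q2) j 0
             / f m (n1 m) (n2 m))%:E)%E),
      (forall i j : 'I_nS,
         cexp Pr (jumps R M1 (stS nE i) (stS nE j)) xi =
         (\sum_(m < n) \sum_(2 <= t <oo) \sum_(1 <= l < t) \sum_(r < nS)
            ((alpha *m mpow P (l%:Z - 1) *m U) 0 r
             * mpow Q1 (t%:Z - l%:Z - 1) r i * Q1 i j
             * (mpow Q1 ((n1 m)%:Z - t%:Z - 1) *m q1) j 0
             * (mpow Q2 ((n2 m)%:Z - l%:Z - 1) *m q2) r 0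
             / f m (n1 m) (n2 m))%:E)%E),
      (forall i j : 'I_nS,
         cexp Pr (jumps R M2 (stS nE i) (stS nE j)) xi =
         (\sum_(m < n) \sum_(2 <= t <oo) \sum_(1 <= l < t) \sum_(r < nS)
            ((alpha *m mpow P (l%:Z - 1) *m U) 0 r
             * mpow Q2 (t%:Z - l%:Z - 1) r i * Q2 i j
             * (mpow Q2 ((n2 m)%:Z - t%:Z - 1) *m q2) j 0
             * (mpow Q1 ((n1 m)%:Z - l%:Z - 1) *m q1) r 0
             / f m (n1 m) (n2 m))%:E)%E),
      (* A jump to the absorbing state at time t is compatible with the data
         only if t is the observed termination time: hence the factor
         (t == _), without which the last two formulas fail. *)
      (forall i : 'I_nS,
         cexp Pr (jumps R M1 (stS nE i) None) xi =
         (\sum_(m < n) \sum_(2 <= t <oo) \sum_(1 <= l < t) \sum_(r < nS)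
            ((t == n1 m)%:R * (alpha *m mpow P (l%:Z - 1) *m U) 0 r
             * mpow Q1 (t%:Z - l%:Z - 1) r i * q1 i 0
             * (mpow Q2 ((n2 m)%:Z - l%:Z - 1) *m q2) r 0
             / f m (n1 m) (n2 m))%:E)%E)
    & (forall i : 'I_nS,
         cexp Pr (jumps R M2 (stS nE i) None) xi =
         (\sum_(m < n) \sum_(2 <= t <oo) \sum_(1 <= l < t) \sum_(r < nS)
            ((t == n2 m)%:R * (alpha *m mpow P (l%:Z - 1) *m U) 0 r
             * mpow Q2 (t%:Z - l%:Z - 1) r i * q2 i 0
             * (mpow Q1 ((n1 m)%:Z - l%:Z - 1) *m q1) r 0
             / f m (n1 m) (n2 m))%:E)%E)]].
Proof.
move=> q1 q2 xi f fc.
have fE m a b : f m a b = prob Pr [set w | obs (M1 m) (M2 m) a b w] by [].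
have s1 m := @sigma_process1 _ _ _ (M1 m) (M2 m).
have s2 m := @sigma_process2 _ _ _ (M1 m) (M2 m).
have mp0 (A : 'M[R]_nE) t : mpow A (t.+1%:Z - 1) = A ^+ t.
  by apply: mpow_pos; lia.
have mpS (A : 'M[R]_nS) t s : (s < t)%N ->
    mpow A (t.+1%:Z - s.+1%:Z - 1) = A ^+ (t - s.+1).
  by move=> st; apply: mpow_pos; lia.
split.
- by move=> m a b _ _; rewrite fE (pr_obs hpar (hpair m)).
- move=> m a b i _ _ ai.
  have M20 w : M2 m 0%N w = M1 m 0%N w by apply: (cp_agree (hpair m)); case: exit_time.
  have -> : [set w | M1 m 0%N w = stE nS i /\ M2 m 0%N w = stE nS i] =
      [set w | M1 m 0%N w = stE nS i].
    by apply/seteqP; split=> w /=; [case|rewrite M20].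
  rewrite /cprob -!/(prob Pr _) (init_stE (hpair m)).
  rewrite (@pr_iff _ _ _ Pr _ [set w | M1 m 0%N w = stE nS i /\ obs (M1 m) (M2 m) a b w]).
    by rewrite (pr_start hpar (hpair m)) mulrC mulKf// gt_eqF.
  by move=> w; split=> -[].
- move=> i.
  apply: (cexp_fin_sum hpair hindep hpos) => m.
    have := s1 m 0%N (stE nS i).
    by congr (pair_sigma _ _ _); apply/seteqP; split=> w /= /eqP.
  rewrite -(pr_start hpar (hpair m)); apply: pr_iff => w.
  by split=> -[/eqP].
- move=> i j.
  apply: (cexp_jumps_from hpair hindep hpos s1
    (fun m t => pr_jumpEE hpar (hpair m) (n1 m) (n2 m) t i j)) => // m t.
  by rewrite mp0.
split.
- move=> i j.
  apply: (cexp_jumps_from hpair hindep hpos s1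
    (fun m t => pr_jumpES hpar (hpair m) (n1 m) (n2 m) t i j)) => // m t.
  by rewrite mp0.
- move=> i j.
  apply: (cexp_jumps_from hpair hindep hpos s1
    (fun m t => pr_jumpSS1 hpar (hpair m) (n1 m) (n2 m) t i j)) => // m t.
    rewrite big_add1 mulr_suml -sumEFin; apply: eq_big_nat => s /andP[_ st].
    rewrite mulr_suml -sumEFin; apply: eq_bigr => r _.
    by rewrite mp0 mpS.
  by rewrite ltnS ltnS leqn0 => /eqP ->; rewrite big_geq.
- move=> i j.
  apply: (cexp_jumps_from hpair hindep hpos s2
    (fun m t => pr_jumpSS2 hpar (hpair m) (n1 m) (n2 m) t i j)) => // m t.
    rewrite big_add1 mulr_suml -sumEFin; apply: eq_big_nat => s /andP[_ st].
    rewrite mulr_suml -sumEFin; apply: eq_bigr => r _.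
    by rewrite mp0 mpS.
  by rewrite ltnS ltnS leqn0 => /eqP ->; rewrite big_geq.
- move=> i.
  apply: (cexp_jumps_from hpair hindep hpos s1
    (fun m t => pr_jumpS01 hpar (hpair m) (n1 m) (n2 m) t i)) => // m t.
    rewrite big_add1 mulr_suml -sumEFin; apply: eq_big_nat => s /andP[_ st].
    rewrite mulr_suml -sumEFin; apply: eq_bigr => r _.
    by rewrite mp0 mpS.
  by rewrite ltnS ltnS leqn0 => /eqP ->; rewrite big_geq.
- move=> i.
  apply: (cexp_jumps_from hpair hindep hpos s2
    (fun m t => pr_jumpS02 hpar (hpair m) (n1 m) (n2 m) t i)) => // m t.
    rewrite big_add1 mulr_suml -sumEFin; apply: eq_big_nat => s /andP[_ st].
    rewrite mulr_suml -sumEFin; apply: eq_bigr => r _.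
    by rewrite mp0 mpS.
  by rewrite ltnS ltnS leqn0 => /eqP ->; rewrite big_geq.
Qed.
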